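(* Suppose that $(\phi_1,\phi_2)\in\mathcal{F}$ and that $a_1,a_2\in\mathcal{M}$ satisfy $a_1\leq a_2$ pointwise on $[0,1]$. Then for all $\alpha\in[0,1]$ and all $x\in\mathbb{R}$, $$P_{\phi,x}(a)\leq \alpha P_{\phi_1,x}(a_1)+(1-\alpha)P_{\phi_2,x}(a_2),$$ where $\phi:=\alpha\phi_1+(1-\alpha)\phi_2$ and $a:=\alpha a_1+(1-\alpha)a_2$.
   Context: $\mathcal{C}$ is the collection of all twice differentiable functions $\phi:\mathbb{R}\to\mathbb{R}$ with $\|\phi'\|_\infty<\infty$ and $\|\phi''\|_\infty<\infty$. $\mathcal{F}_1$ is the set of pairs $(\phi_1,\phi_2)$ with $\phi_1,\phi_2\in\mathcal{C}$ both nondecreasing and convex, $\phi_1\leq\phi_2$ on $\mathbb{R}$ and $\phi_1'\leq\phi_2'$ on $\mathbb{R}$. $\mathcal{F}_2$ is the set of pairs $(\phi_1,\phi_2)$ with $\phi_1,\phi_2\in\mathcal{C}$ both even and convex, $\phi_1\leq\phi_2$ on $\mathbb{R}$ and $\phi_1'(x)\leq\phi_2'(x)$ for all $x\geq 0$. Set $\mathcal{F}=\mathcal{F}_1\cup\mathcal{F}_2$. $\mathcal{M}$ is the collection of all nonincreasing, left-continuous functions $a:[0,1]\to[0,1]$. For $\phi\in\mathcal{C}$ and $a\in\mathcal{M}$, $F_{\phi,a}$ denotes the solution of $$\partial_tF_{\phi,a}(x,t)=\tfrac12\left(\partial_{xx}F_{\phi,a}(x,t)+a(t)(\partial_xF_{\phi,a}(x,t))^2\right),\quad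 (x,t)\in\mathbb{R}\times[0,1],\qquad F_{\phi,a}(x,0)=\phi(x),$$ in the following sense. If $a\in\mathcal{M}$ is a step function, equal to $m_j$ on $(t_j,t_{j+1}]$ for $0\le j\le k$ with $0=t_0<t_1<\dots<t_{k+1}=1$, then $F_{\phi,a}$ is given recursively by $F_{\phi,a}(x,0)=\phi(x)$ and $$F_{\phi,a}(x,t)=\frac{1}{m_j}\log\mathbb{E}\exp\left(m_jF_{\phi,a}(x+\sqrt{t-t_j}\,z,t_j)\right),\quad t\in(t_j,t_{j+1}],$$ where $z$ is a standard Gaussian random variable (the right-hand side is read as $\mathbb{E}F_{\phi,a}(x+\sqrt{t-t_j}\,z,t_j)$ when $m_j=0$). On step functions, $a\mapsto F_{\phi,a}(x,t)$ is Lipschitz with respect to the $L^1([0,1])$ norm, uniformly in $(x,t)\in\mathbb{R}\times[0,1]$, and for general $a\in\mathcal{M}$, $F_{\phi,a}(x,t)$ is defined as the limit of $F_{\phi,a_k}(x,t)$ along step functions $a_k\in\mathcal{M}$ with $a_k\to a$ in $L^1([0,1])$. The Parisi functional is $P_{\phi,x}(a):=F_{\phi,a}(x,1)$ for $a\in\mathcal{M}$, $x\in\mathbb{R}$. *)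

(* Defs.v *)
From HB Require Import structures.
From mathcomp Require Import all_boot all_order all_algebra.
From mathcomp Require Import all_classical all_reals all_analysis.
Import Order.TTheory GRing.Theory Num.Theory.
Import numFieldNormedType.Exports.

Set Implicit Arguments.
Unset Strict Implicit.
Unset Printing Implicit Defensive.

Local Open Scope ring_scope.
Local Open Scope classical_set_scope.

Section Parisi.
Variable R : realType.

Definition classC : set (R -> R) := [set phi : R -> R |
  [/\ forall x : R, derivable phi x 1,
      forall x : R, derivable phi^`() x 1,
      exists B, forall x, `|phi^`() x| <= B &
      exists B, forall x, `|phi^`(2) x| <= B]].

Definition convexR (phi : R -> R) : Prop := convex_function (setT : set R^o) phi.

Definition classF1 : set ((R -> R) * (R -> R)) := [set p : (R -> R) * (R -> R) |
  [/\ classC p.1 /\ classC p.2,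
      {homo p.1 : x y / x <= y} /\ {homo p.2 : x y / x <= y},
      convexR p.1 /\ convexR p.2,
      forall x, p.1 x <= p.2 x &
      forall x, p.1^`() x <= p.2^`() x]].

Definition classF2 : set ((R -> R) * (R -> R)) := [set p : (R -> R) * (R -> R) |
  [/\ classC p.1 /\ classC p.2,
      (forall x, p.1 (- x) = p.1 x) /\ (forall x, p.2 (- x) = p.2 x),
      convexR p.1 /\ convexR p.2,
      forall x, p.1 x <= p.2 x &
      forall x, 0 <= x -> p.1^`() x <= p.2^`() x]].

Definition classF : set ((R -> R) * (R -> R)) := classF1 `|` classF2.

(* A function on [0, 1] is represented by a total function on R whose values
   outside [0, 1] are irrelevant.  Left continuity carries no information at
   t = 0, and for t > 0 only the values on ]0, t] matter. *)
Definition classM : set (R -> R) := [set a : R -> R |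
  [/\ forall t : R, 0 <= t <= 1 -> 0 <= a t <= 1,
      forall s t : R, 0 <= s -> s <= t -> t <= 1 -> a t <= a s &
      forall t : R, 0 < t <= 1 -> a s @[s --> t^'-] --> a t]].

(* A step function on ]t_0, 1] is encoded by t_0 and the list of pairs
   (t_1, m_0), ..., (t_{k+1}, m_k): it equals m_j on ]t_j, t_{j+1}], and the
   last node is 1.  The value at t_0 is left free. *)
Fixpoint step_repr (a : R -> R) (t0 : R) (s : seq (R * R)) : Prop :=
  match s with
  | [::] => t0 = 1
  | (t1, m) :: s' =>
      [/\ t0 < t1, forall t, t0 < t <= t1 -> a t = m & step_repr a t1 s']
  end.

(* (1/m) log E exp(m f(x + sqrt h z)), or E f(x + sqrt h z) when m = 0, the
   expectation being taken under the law N(0, 1) of z. *)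
Definition gauss_step (m h : R) (f : R -> R) (x : R) : R :=
  let E (g : R -> R) := fine (expectation (normal_prob (0 : R) 1) g) in
  if m == 0 then E (fun z => f (x + Num.sqrt h * z))
  else m^-1 * ln (E (fun z => expR (m * f (x + Num.sqrt h * z)))).

(* The initial datum [phi] is prescribed at time [t0]; on each crossed interval
   it is replaced by the solution at the right endpoint of that interval. *)
Fixpoint step_sol (phi : R -> R) (t0 : R) (s : seq (R * R)) (x t : R) : R :=
  match s with
  | [::] => phi x
  | (t1, m) :: s' =>
      if t <= t0 then phi x
      else if t <= t1 then gauss_step m (t - t0) phi x
      else step_sol (gauss_step m (t1 - t0) phi) t1 s' x t
  end.

Definition L1_cvg (a_ : nat -> R -> R) (a : R -> R) : Prop :=
  (\int[lebesgue_measure]_(t in `[0%R, 1%R]) `|a_ k t - a t|%:E)%E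
    @[k --> \oo] --> 0%E.

(* The common limit along all step functions a_k in classM converging to a in
   L^1([0, 1]).  It exists and is unique for phi in classC and a in classM, by
   the L^1-Lipschitz continuity of the solution on step functions; for a step
   function a (constant sequence) it is given by the recursion [step_sol],
   whatever the list representing a. *)
Definition parisi_sol (phi : R -> R) (a : R -> R) (x t : R) : R :=
  get [set l : R |
    forall (a_ : nat -> R -> R) (s_ : nat -> seq (R * R)),
      (forall k, classM (a_ k)) ->
      (forall k, step_repr (a_ k) 0 (s_ k)) ->
      L1_cvg a_ a ->
      step_sol phi 0 (s_ k) x t @[k --> \oo] --> l].

Definition parisi_functional (phi : R -> R) (x : R) (a : R -> R) : R :=
  parisi_sol phi a x 1.

End Parisi.

(* Main.v *)
Require Import Defs.
From HB Require Import structures.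
From mathcomp Require Import all_boot all_order all_algebra.
From mathcomp Require Import all_classical all_reals all_analysis.
From mathcomp Require Import measurable_realfun ring lra.
Import Order.TTheory GRing.Theory Num.Theory.
Import numFieldNormedType.Exports.

Set Implicit Arguments.
Unset Strict Implicit.
Unset Printing Implicit Defensive.

Local Open Scope ring_scope.
Local Open Scope classical_set_scope.

(** Over a time [h] during which the parameter is constant and equal to [m], the
solution map is [gauss_step m h], the flow of dF/dt = (F'' + m F'^2) / 2.  Let
[F1] and [F2] follow this flow with parameters m1 <= m2 and suppose that
|F1'| <= |F2'|.  With p = F1', q = F2' and m = t m1 + (1 - t) m2,
<<
  t m1 p^2 + (1-t) m2 q^2 - m (t p + (1-t) q)^2
    = t (1-t) ((m2 - m1) (q^2 - p^2) + m (p - q)^2) >= 0,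
>>
so t F1 + (1-t) F2 is a supersolution for the parameter m and stays above the
solution started from below it.  What has to be shown is that the domination of
the gradients survives the flow; convexity of the larger datum is what makes
this true.

The argument is carried out below without derivatives in x or t.

- Domination of gradients is replaced by the statement that f2 - f1 is monotone
  ([monob], [dominated]): in x for pairs in [classF1], in |x| for pairs in
  [classF2].  It follows that the increments of f1 are smaller than those of f2
  ([dominated_increments]).

- The steps form a semigroup ([gauss_step_semigroup], from the rotation
  invariance of the standard Gaussian law on the plane), so a step may be cut
  into n short ones.  On a short step the operator is the mean plus m/2 times
  the variance, up to h^(3/2) ([gauss_step_expansion]); the n errors add up to
  something of order n^(-1/2) ([le_subdivision]).  Comparing steps with
  different parameters thus amounts to comparing variances.

- A variance is half the mean square difference of two independent samples, so
  the identity displayed above, applied to increments of f1 and f2 in place of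
  p and q, gives the inequality for one short step ([var_convex_comb]) and then
  for one step of any length ([gauss_step_convex_param]).

- For a common parameter, monotonicity of f2 - f1 is preserved because the
  Gaussian kernel, folded into a hyperbolic cosine in the even case, is totally
  positive ([kernel_TP2], [monob_gauss_step]).  Raising the parameter adds a
  multiple of the variance, which is monotone for a convex monotone function:
  after a rotation by 45 degrees it is an average of squares of symmetric
  increments ([monob_var], [monob_gauss_step_param]).

Composing the steps along a uniform grid proves the inequality for step
functions ([run_steps_grid_convex]).  A step depends on its parameter in a
Lipschitz way ([gauss_step_lip_param]), hence solutions are Lipschitz in the L^1
distance of the step functions ([run_steps_dist]), and the values of the Parisi
functional are limits along the grid ([parisi_sol_cvg], [grid_L1_cvg]). *)

(** * Gaussian integrals and rotation invariance *)

Section GaussianIntegrals.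
Context {R : realType}.
Local Notation mu := (@lebesgue_measure R).
Local Notation gamma := (normal_prob (0 : R) 1).
Local Notation pdf := (normal_pdf (0 : R) 1).

Lemma measurable_shift (c : R) : measurable_fun setT (fun x : R => x + c).
Proof. exact: measurable_funD. Qed.

Lemma lebesgue_measure_shift (c : R) (A : set R) : measurable A ->
  pushforward mu ((fun x => x + c) : measurableTypeR R -> measurableTypeR R) A = mu A.
Proof.
move=> mA; apply/esym/lebesgue_measure_unique => //=.
  exact: measurable_shift.
move=> ? _ [[a b]] _ <-.
rewrite /pushforward.
rewrite (_ : _ @^-1` _ = `]a - c, b - c]%classic); last first.
  by apply/seteqP; split => x; rewrite /= !in_itv/= ltrBlDr lerBrDr.
rewrite !lebesgue_measure_itv/= !lte_fin ltrD2r.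
by case: ifP => // _; rewrite -EFinD; congr EFin; lra.
Qed.

Lemma ge0_integral_shift (c : R) (f : R -> \bar R) :
  measurable_fun setT f -> (forall x, 0 <= f x)%E ->
  (\int[mu]_x f (x + c)%R = \int[mu]_x f x)%E.
Proof.
move=> mf f0.
pose phi : measurableTypeR R -> measurableTypeR R := fun x => (x + c)%R.
have mphi : measurable_fun setT phi := measurable_shift c.
transitivity (\int[pushforward mu phi]_x f x)%E; last first.
  by apply: eq_measure_integral => A mA _; exact: lebesgue_measure_shift.
by rewrite (ge0_integral_pushforward mphi)//= preimage_setT.
Qed.

Lemma ge0_integral_oppr (f : R -> \bar R) :
  measurable_fun setT f -> (forall x, 0 <= f x)%E ->
  (\int[mu]_x f (- x)%R = \int[mu]_x f x)%E.
Proof.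
move=> mf f0.
pose phi : measurableTypeR R -> measurableTypeR R := -%R.
have mphi : measurable_fun setT phi by apply/measurable_funN/measurable_id.
transitivity (\int[pushforward mu phi]_x f x)%E.
  by rewrite (ge0_integral_pushforward mphi)//= preimage_setT.
by apply: eq_measure_integral => A mA _; exact: lebesgue_measureN.
Qed.

Lemma pdfE (z : R) : pdf z = normal_peak 1 * expR (- z ^+ 2 / 2).
Proof. by rewrite normal_pdfE ?oner_neq0// /normal_fun subr0 expr1n. Qed.

Import HBNNSimple.

(** [normal_prob] is defined by its density, so the formula holds for indicators;
simple functions and monotone convergence do the rest. *)
Lemma ge0_integral_gauss_density (f : R -> \bar R) :
  measurable_fun setT f -> (forall x, 0 <= f x)%E ->
  (\int[gamma]_x f x = \int[mu]_x (f x * (pdf x)%:E))%E.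
Proof.
move=> mf f0.
have mpdf : measurable_fun setT (fun x => (pdf x)%:E).
  by apply/measurable_EFinP; exact: measurable_normal_pdf.
have pdf0 x : (0 <= (pdf x)%:E)%E by rewrite lee_fin normal_pdf_ge0.
have Hindic (E : set R) : measurable E ->
    (\int[gamma]_x (\1_E x)%:E = \int[mu]_x ((\1_E x)%:E * (pdf x)%:E))%E.
  move=> mE; rewrite integral_indic//= setIT /normal_prob integral_mkcond.
  apply: eq_integral => x _; rewrite patchE indicE.
  by case: ifPn => xE; rewrite ?xE ?(negbTE xE) ?mul1e ?mul0e.
have Hnn (g : {nnsfun R >-> R}) :
    (\int[gamma]_x (g x)%:E = \int[mu]_x ((g x)%:E * (pdf x)%:E))%E.
  under [LHS]eq_integral do rewrite fimfunE -fsumEFin//.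
  have mind (r : R) : measurable_fun setT (fun x => (r * \1_(g @^-1` [set r]) x)%:E).
    apply/measurable_EFinP; apply: measurable_funM; first exact: measurable_cst.
    exact/measurable_indic.
  have mind1 (r : R) : measurable_fun setT (fun x => (\1_(g @^-1` [set r]) x : R)%:E).
    by apply/measurable_EFinP; exact/measurable_indic.
  rewrite [LHS]ge0_integral_fsum//; last first.
    by move=> n x _; rewrite EFinM nnfun_muleindic_ge0.
  under [RHS]eq_integral.
    move=> x xD; rewrite fimfunE -fsumEFin// ge0_mule_fsuml; last first.
      by move=> r; rewrite EFinM nnfun_muleindic_ge0.
    over.
  rewrite [RHS]ge0_integral_fsum//; last 2 first.
  - by move=> r; exact: emeasurable_funM (mind r) mpdf.
  - by move=> n x _; rewrite mule_ge0// EFinM nnfun_muleindic_ge0.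
  apply: eq_fsbigr => r; rewrite inE => -[x _ gxr].
  have r0 : 0 <= r by rewrite -gxr fun_ge0.
  under eq_integral do rewrite EFinM.
  rewrite ge0_integralZl//; last exact: (mind1 r).
  under [RHS]eq_integral do rewrite EFinM -muleA.
  rewrite ge0_integralZl//; last 2 first.
  - exact: emeasurable_funM (mind1 r) mpdf.
  - by move=> t _; rewrite mule_ge0// lee_fin.
  by rewrite Hindic.
pose f_ := nnsfun_approx measurableT mf.
have ndf_ m n x : (m <= n)%N -> f_ m x <= f_ n x.
  by move=> mn; exact/lefP/nd_nnsfun_approx.
have mf_ n : measurable_fun setT (fun x => (f_ n x)%:E).
  by apply/measurable_EFinP; exact: measurable_funPT.
transitivity (limn (fun n => \int[gamma]_x (f_ n x)%:E))%E.
  rewrite -monotone_convergence//=.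
  - apply: eq_integral => ? /[!inE] xD; apply/esym/cvg_lim => //=.
    exact: cvg_nnsfun_approx.
  - by move=> n ? _; rewrite lee_fin.
  - by move=> x _ m n mn; rewrite lee_fin; exact: ndf_.
transitivity (limn (fun n => \int[mu]_x ((f_ n x)%:E * (pdf x)%:E)))%E.
  by apply: congr_lim; apply/funext => n /=; exact: Hnn.
rewrite -monotone_convergence//=.
- apply: eq_integral => x _; apply/cvg_lim => //=.
  apply: cvgeZr => //; exact: cvg_nnsfun_approx.
- by move=> n; exact: emeasurable_funM (mf_ n) mpdf.
- by move=> n ? _; rewrite mule_ge0// lee_fin.
- by move=> x _ m n mn; rewrite lee_wpmul2r// lee_fin; exact: ndf_.
Qed.

Lemma measurable_EFin_gauss_pdf : measurable_fun setT (fun x => (pdf x)%:E).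
Proof. by apply/measurable_EFinP; exact: measurable_normal_pdf. Qed.

Lemma gauss_pdf_ge0 x : (0 <= (pdf x)%:E)%E.
Proof. by rewrite lee_fin normal_pdf_ge0. Qed.

(** Cameron-Martin formula: translating the sample multiplies the density by an
exponential. *)
Lemma ge0_integral_gauss_shift (c : R) (f : R -> \bar R) :
  measurable_fun setT f -> (forall x, 0 <= f x)%E ->
  (\int[gamma]_z f (z + c)%R =
   \int[gamma]_z (f z * (expR (c * z - c ^+ 2 / 2))%:E))%E.
Proof.
move=> mf f0.
have mpc : measurable_fun setT (fun z : R => (pdf (z - c))%:E).
  exact: measurableT_comp measurable_EFin_gauss_pdf (measurable_shift (- c)).
have mexp : measurable_fun setT (fun z : R => (expR (c * z - c ^+ 2 / 2))%:E).
  apply/measurable_EFinP; apply: measurableT_comp => //.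
  by apply: measurable_funB => //; apply: measurable_funM.
rewrite ge0_integral_gauss_density//; last first.
  exact: measurableT_comp mf (measurable_shift c).
rewrite ge0_integral_gauss_density//; last 2 first.
- exact: emeasurable_funM.
- by move=> z; rewrite mule_ge0// lee_fin expR_ge0.
rewrite -[RHS](ge0_integral_shift c); last 2 first.
- apply: emeasurable_funM; first exact: emeasurable_funM.
  exact: measurable_EFin_gauss_pdf.
- by move=> z; rewrite !mule_ge0// ?lee_fin ?expR_ge0 ?normal_pdf_ge0.
apply: eq_integral => z _; rewrite -muleA -EFinM; congr (_ * _%:E)%E.
rewrite !pdfE mulrCA -expRD; by congr (_ * expR _); field.
Qed.

Lemma ge0_integral_gauss_oppr (f : R -> \bar R) :
  measurable_fun setT f -> (forall x, 0 <= f x)%E ->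
  (\int[gamma]_z f (- z)%R = \int[gamma]_z f z)%E.
Proof.
move=> mf f0.
have mN : measurable_fun setT (fun z : R => - z).
  by apply/measurable_funN/measurable_id.
rewrite ge0_integral_gauss_density//; last exact: measurableT_comp mf mN.
rewrite ge0_integral_gauss_density// -[RHS]ge0_integral_oppr; last 2 first.
- exact: emeasurable_funM mf measurable_EFin_gauss_pdf.
- by move=> z; rewrite mule_ge0// gauss_pdf_ge0.
by apply: eq_integral => z _; rewrite !pdfE sqrrN.
Qed.

Definition lebesgue2 (F : R * R -> \bar R) : \bar R :=
  (\int[mu]_u \int[mu]_v F (u, v))%E.

Definition gauss2 (F : R * R -> \bar R) : \bar R :=
  (\int[gamma]_u \int[gamma]_v F (u, v))%E.

Lemma gauss2_density (F : R * R -> \bar R) :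
  measurable_fun setT F -> (forall x, 0 <= F x)%E ->
  gauss2 F = lebesgue2 (fun p => F p * (pdf p.1 * pdf p.2)%:E)%E.
Proof.
move=> mF F0.
have mFu u : measurable_fun setT (fun v => F (u, v)) by exact: measurableT_comp.
rewrite /gauss2 ge0_integral_gauss_density; last 2 first.
- exact: (measurable_fun_fubini_tonelli_F (m2 := gamma) F).
- by move=> u; exact: integral_ge0.
apply: eq_integral => u _.
rewrite ge0_integral_gauss_density// -ge0_integralZr//; last 3 first.
- by apply: emeasurable_funM (mFu u) measurable_EFin_gauss_pdf.
- by move=> v _; rewrite mule_ge0// gauss_pdf_ge0.
- exact: gauss_pdf_ge0.
by apply: eq_integral => v _; rewrite -muleA -EFinM [(pdf v * _)%R]mulrC.
Qed.

Lemma lebesgue2_swap (F : R * R -> \bar R) :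
  measurable_fun setT F -> (forall x, 0 <= F x)%E ->
  lebesgue2 F = (\int[mu]_v \int[mu]_u F (u, v))%E.
Proof. exact: (@fubini_tonelli _ _ _ _ _ mu mu F). Qed.

Lemma measurable_fun_linear2 (a b : R) :
  measurable_fun setT (fun p : R * R => a * p.1 + b * p.2).
Proof.
have m1 : measurable_fun setT (fun p : R * R => p.1) by exact: measurable_fst.
have m2 : measurable_fun setT (fun p : R * R => p.2) by exact: measurable_snd.
by apply: measurable_funD; apply: measurable_funM.
Qed.

Lemma measurable_comp_linear2 d (T : measurableType d) (a b c e : R)
    (F : R * R -> T) : measurable_fun setT F ->
  measurable_fun setT (fun p : R * R =>
    F (a * p.1 + b * p.2, c * p.1 + e * p.2)).
Proof.
move=> mF; apply: measurableT_comp mF _.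
by apply/measurable_fun_pair; exact: measurable_fun_linear2.
Qed.

Lemma lebesgue2_shearr (k : R) (F : R * R -> \bar R) :
  measurable_fun setT F -> (forall x, 0 <= F x)%E ->
  lebesgue2 (fun p => F (1 * p.1 + 0 * p.2, k * p.1 + 1 * p.2)) = lebesgue2 F.
Proof.
move=> mF F0; apply: eq_integral => u _ /=.
have mFu : measurable_fun setT (fun v => F (u, v)) by exact: measurableT_comp.
rewrite -[RHS](ge0_integral_shift (k * u) mFu)//.
by apply: eq_integral => v _; rewrite !mul1r mul0r addr0 addrC.
Qed.

Lemma lebesgue2_shearl (k : R) (F : R * R -> \bar R) :
  measurable_fun setT F -> (forall x, 0 <= F x)%E ->
  lebesgue2 (fun p => F (1 * p.1 + k * p.2, 0 * p.1 + 1 * p.2)) = lebesgue2 F.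
Proof.
move=> mF F0.
have mG := measurable_comp_linear2 1 k 0 1 mF.
apply: (etrans (lebesgue2_swap mG _)); first by [].
apply/esym/(etrans (lebesgue2_swap mF F0))/eq_integral => v _ /=.
have mFv : measurable_fun setT (fun u => F (u, v)) by exact: measurableT_comp.
rewrite -[LHS](ge0_integral_shift (k * v) mFv)//.
by apply: eq_integral => u _; rewrite !mul1r mul0r add0r.
Qed.

(** A rotation is a product of three shears, with coefficients [k], [s], [k] for
k = (c - 1) / s; each shear preserves Lebesgue measure by translation invariance
in one variable, and the density depends on the radius only. *)
Lemma gauss2_rotation (c s : R) (F : R * R -> \bar R) :
  c ^+ 2 + s ^+ 2 = 1 -> s != 0 ->
  measurable_fun setT F -> (forall x, 0 <= F x)%E ->
  gauss2 (fun p => F (c * p.1 + - s * p.2, s * p.1 + c * p.2)) = gauss2 F.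
Proof.
move=> cs s0 mF F0.
pose k := - ((1 - c) / s).
have mpp : measurable_fun setT (fun p : R * R => (pdf p.1 * pdf p.2)%:E).
  apply/measurable_EFinP; apply: measurable_funM.
    exact: measurableT_comp (measurable_normal_pdf _ _) measurable_fst.
  exact: measurableT_comp (measurable_normal_pdf _ _) measurable_snd.
pose G (p : R * R) := (F p * (pdf p.1 * pdf p.2)%:E)%E.
have mG : measurable_fun setT G by exact: emeasurable_funM.
have G0 p : (0 <= G p)%E.
  by rewrite mule_ge0// lee_fin mulr_ge0 ?normal_pdf_ge0.
have mG1 := measurable_comp_linear2 1 k 0 1 mG.
have mG2 := measurable_comp_linear2 1 0 s 1 mG1.
have <- : lebesgue2 G = gauss2 F by exact/esym/gauss2_density.
rewrite -(lebesgue2_shearl k mG G0).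
rewrite -(lebesgue2_shearr s mG1 (fun=> G0 _)).
rewrite -(lebesgue2_shearl k mG2 (fun=> G0 _)).
apply: (etrans (gauss2_density (measurable_comp_linear2 _ _ _ _ mF) (fun=> F0 _))).
congr lebesgue2; apply/funext => -[u v] /=.
have ks : k * s = c - 1 by rewrite /k mulNr divfK//; lra.
have kc : k * (c + 1) = - s.
  apply: (mulfI s0).
  rewrite mulrA [s * k]mulrC ks mulrDr mulr1.
  by move: cs; rewrite !expr2 => cs; lra.
set u1 := (X in G (X, _)); set v1 := (X in G (_, X)).
have -> : u1 = c * u + - s * v.
  have -> : u1 = u + k * v + (k * s) * u + k * s * (k * v) + k * v by rewrite /u1; ring.
  by rewrite ks -kc; ring.
have -> : v1 = s * u + c * v.
  have -> : v1 = s * u + (k * s) * v + v by rewrite /v1; ring.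
  by rewrite ks; ring.
rewrite /G/=; congr (_ * _%:E)%E.
rewrite !pdfE mulrACA -expRD [RHS]mulrACA -expRD; congr (_ * expR _).
rewrite -!mulrDl -!opprD; congr (- _ / _).
rewrite -[LHS]mul1r -cs; ring.
Qed.

End GaussianIntegrals.

(** * Gaussian expectation of functions of exponential growth *)

Section GaussianExpectation.
Context {R : realType}.
Local Notation gamma := (normal_prob (0 : R) 1).
Implicit Types (f g : R -> R) (A B L m : R).

Definition gE g : R := fine (\int[gamma]_z (g z)%:E)%E.

(** A class stable under the operations used below whose members are all
integrable for the Gaussian law, so that [gE] is linear and monotone on it. *)
Definition expgrowth g : Prop := measurable_fun setT g /\
  exists A B, forall z, `|g z| <= A * expR (B * `|z|).

Definition lip L f : Prop := forall x y, `|f x - f y| <= L * `|x - y|.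

Lemma measurable_expRabs B : measurable_fun setT (fun z : R => expR (B * `|z|)).
Proof.
apply: measurableT_comp => //; exact: measurable_funM.
Qed.

Lemma integrable_expRabs B :
  gamma.-integrable setT (fun z => (expR (B * `|z|))%:E).
Proof.
have mB : measurable_fun setT (fun z : R => (expR (B * `|z|))%:E).
  by apply/measurable_EFinP; exact: measurable_expRabs.
have mexp c : measurable_fun setT (fun z : R => (expR (c * z - c ^+ 2 / 2))%:E).
  apply/measurable_EFinP; apply: measurableT_comp => //.
  by apply: measurable_funB => //; apply: measurable_funM.
(* The translation formula for the constant function 1. *)
have E1 c : (\int[gamma]_z (expR (c * z - c ^+ 2 / 2))%:E = 1)%E.
  have := @ge0_integral_gauss_shift R c (cst 1%E) (measurable_cst _) (fun=> lee01).
  under [X in _ = X -> _]eq_integral do rewrite mul1e.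
  by move=> <-; rewrite integral_cst//= probability_setT mule1.
pose h (z : R) : \bar R := ((expR (B ^+ 2 / 2))%:E *
  ((expR (B * z - B ^+ 2 / 2))%:E + (expR (- B * z - (- B) ^+ 2 / 2))%:E))%E.
have mh : measurable_fun setT h.
  apply: emeasurable_funM; first exact: measurable_cst.
  exact: emeasurable_funD (mexp B) (mexp (- B)).
apply/integrableP; split => //.
apply: (@le_lt_trans _ _ (\int[gamma]_z h z)%E).
  apply: ge0_le_integral => //.
  - exact: measurableT_comp mB.
  - move=> z _; rewrite /h gee0_abs ?lee_fin ?expR_ge0// mulrDr -!expRD.
    case: (lerP 0 z) => z0.
      apply: (@le_trans _ _ (expR (B * z))); first by rewrite ler_expR ger0_norm.
      rewrite (_ : B ^+ 2 / 2 + (B * z - B ^+ 2 / 2) = B * z); last by ring.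
      by rewrite lerDl expR_ge0.
    apply: (@le_trans _ _ (expR (- B * z))).
      by rewrite ler_expR ltr0_norm// mulrN mulNr.
    rewrite (_ : B ^+ 2 / 2 + (- B * z - (- B) ^+ 2 / 2) = - B * z); last by ring.
    by rewrite lerDr expR_ge0.
rewrite ge0_integralZl//; last 2 first.
- exact: (emeasurable_funD (mexp B) (mexp (- B))).
- by move=> z _; rewrite adde_ge0// lee_fin expR_ge0.
rewrite ge0_integralD//; last 2 first.
- exact: mexp.
- exact: mexp.
by rewrite !E1 -EFinD -EFinM ltry.
Qed.

Lemma expgrowth_integrable g : expgrowth g ->
  gamma.-integrable setT (EFin \o g).
Proof.
move=> [mg [A [B gAB]]].
have iAB : gamma.-integrable setT (fun z => A%:E * (expR (B * `|z|))%:E)%E.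
  by apply: integrableZl => //; exact: integrable_expRabs.
apply: (le_integrable _ _ _ iAB) => //.
- exact/measurable_EFinP.
- move=> z _ /=; rewrite lee_fin.
  by apply: le_trans (gAB z) _; exact: ler_norm.
Qed.

Lemma EFin_gE g : expgrowth g -> (gE g)%:E = (\int[gamma]_z (g z)%:E)%E.
Proof.
move=> /expgrowth_integrable gi; rewrite /gE fineK//.
exact: integrable_fin_num.
Qed.

Lemma expgrowth_measurable g : expgrowth g -> measurable_fun setT g.
Proof. by case. Qed.

Lemma expgrowthP g : expgrowth g -> exists A B, [/\ 0 <= A, 0 <= B &
  forall z, `|g z| <= A * expR (B * `|z|)].
Proof.
move=> [_ [A [B gAB]]]; exists `|A|, `|B|; split => // z.
apply: le_trans (gAB z) _; apply: (@le_trans _ _ (`|A| * expR (B * `|z|))).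
  by rewrite ler_wpM2r ?expR_ge0// ler_norm.
by rewrite ler_wpM2l// ler_expR ler_wpM2r// ler_norm.
Qed.

Lemma expgrowth_le g g' : measurable_fun setT g -> expgrowth g' ->
  (forall z, `|g z| <= `|g' z|) -> expgrowth g.
Proof.
move=> mg [_ [A [B gAB]]] gg'; split=> //; exists A, B => z.
exact: le_trans (gAB z).
Qed.

Lemma expgrowth_cst c : expgrowth (fun=> c).
Proof.
split; first exact: measurable_cst.
by exists `|c|, 0 => z; rewrite mul0r expR0 mulr1.
Qed.

Lemma expgrowthM g g' : expgrowth g -> expgrowth g' ->
  expgrowth (fun z => g z * g' z).
Proof.
move=> eg eg'; split.
  by apply: measurable_funM; exact: expgrowth_measurable.
have [A [B [A0 B0 gAB]]] := expgrowthP eg.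
have [A' [B' [A'0 B'0 gAB']]] := expgrowthP eg'.
exists (A * A'), (B + B') => z.
by rewrite normrM mulrDl expRD mulrACA ler_pM.
Qed.

Lemma expgrowthD g g' : expgrowth g -> expgrowth g' ->
  expgrowth (fun z => g z + g' z).
Proof.
move=> eg eg'; split.
  by apply: measurable_funD; exact: expgrowth_measurable.
have [A [B [A0 B0 gAB]]] := expgrowthP eg.
have [A' [B' [A'0 B'0 gAB']]] := expgrowthP eg'.
exists (A + A'), (B + B') => z.
apply: le_trans (ler_normD _ _) _; rewrite mulrDl lerD//.
  apply: le_trans (gAB z) _; rewrite ler_wpM2l// ler_expR ler_wpM2r//.
  by rewrite lerDl.
apply: le_trans (gAB' z) _; rewrite ler_wpM2l// ler_expR ler_wpM2r//.
by rewrite lerDr.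
Qed.

Lemma expgrowthZ c g : expgrowth g -> expgrowth (fun z => c * g z).
Proof. by move=> eg; exact: expgrowthM (expgrowth_cst c) eg. Qed.

Lemma expgrowthN g : expgrowth g -> expgrowth (fun z => - g z).
Proof.
move=> eg; apply: (expgrowth_le _ eg).
  by apply/measurable_funN; exact: expgrowth_measurable.
by move=> z; rewrite normrN.
Qed.

Lemma expgrowthB g g' : expgrowth g -> expgrowth g' ->
  expgrowth (fun z => g z - g' z).
Proof. by move=> eg /expgrowthN; exact: expgrowthD. Qed.

Lemma expgrowthX g n : expgrowth g -> expgrowth (fun z => g z ^+ n).
Proof.
move=> eg; elim: n => [|n IH]; first exact: expgrowth_cst.
rewrite (_ : (fun _ => _) = fun z => g z * g z ^+ n); first exact: expgrowthM.
by apply/funext => z; rewrite exprS.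
Qed.

Lemma expgrowth_abs g : expgrowth g -> expgrowth (fun z => `|g z|).
Proof.
move=> eg; apply: (expgrowth_le _ eg).
  by apply: measurableT_comp => //; case: eg.
by move=> z; rewrite normr_id.
Qed.

Lemma expgrowth_id : expgrowth id.
Proof.
split; first exact: measurable_id.
exists 1, 1 => z; rewrite !mul1r.
by apply: le_trans (expR_ge1Dx _); rewrite lerDr.
Qed.

Lemma expgrowth_affine g x r : expgrowth g -> expgrowth (fun z => g (x + r * z)).
Proof.
move=> eg; have [A [B [A0 B0 gAB]]] := expgrowthP eg; split.
  apply: measurableT_comp; first by case: eg.
  by apply: measurable_funD => //; exact: measurable_funM.
exists (A * expR (B * `|x|)), (B * `|r|) => z.
apply: le_trans (gAB _) _; rewrite -mulrA -expRD ler_wpM2l// ler_expR.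
by rewrite -mulrA -mulrDr ler_wpM2l// -normrM ler_normD.
Qed.

Lemma lip_ge0 L f : lip L f -> 0 <= L.
Proof. by move=> /(_ 1 0); rewrite subr0 normr1 mulr1; exact: le_trans. Qed.

Lemma lip_continuous L f : lip L f -> continuous f.
Proof.
move=> fL x; have L0 := lip_ge0 fL.
apply/cvgrPdist_le => /= e e0.
near=> y; apply: le_trans (fL x y) _.
have L1 : 0 < L + 1 by lra.
apply: (@le_trans _ _ ((L + 1) * `|x - y|)).
  by rewrite ler_wpM2r// lerDl.
rewrite mulrC -ler_pdivlMr//.
near: y; apply: cvgr_dist_le => //; rewrite divr_gt0//; lra.
Unshelve. all: by end_near. Qed.

Lemma lip_measurable L f : lip L f -> measurable_fun setT f.
Proof. by move=> /lip_continuous; exact: continuous_measurable_fun. Qed.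

Lemma lip_expgrowth L f : lip L f -> expgrowth f.
Proof.
move=> fL; split; first exact: lip_measurable fL.
have L0 := lip_ge0 fL.
exists (`|f 0| + L), 1 => z; rewrite mul1r.
have := fL z 0; rewrite subr0 => fz.
apply: (@le_trans _ _ (`|f 0| + L * `|z|)).
  by rewrite -lerBlDl; apply: le_trans fz; exact: lerB_dist.
have e1 := expR_ge1Dx `|z|; have z0 := normr_ge0 z; have f0 := normr_ge0 (f 0).
rewrite mulrDl lerD//; last by rewrite ler_wpM2l//; lra.
by rewrite ler_peMr//; lra.
Qed.

Lemma lip_expgrowth_expR L f m : lip L f -> expgrowth (fun z => expR (m * f z)).
Proof.
move=> fL; split.
  apply: measurableT_comp => //; apply: measurable_funM => //.
  exact: lip_measurable fL.
exists (expR (`|m| * `|f 0|)), (`|m| * L) => z.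
rewrite ger0_norm ?expR_ge0// -expRD ler_expR.
have := fL z 0; rewrite subr0 => fz.
apply: le_trans (ler_norm _) _; rewrite normrM -mulrA -mulrDr ler_wpM2l//.
by rewrite -lerBlDl; apply: le_trans fz; exact: lerB_dist.
Qed.

Lemma gE_cst c : gE (fun=> c) = c.
Proof. by rewrite /gE integral_cst//= probability_setT mule1. Qed.

Lemma gED g g' : expgrowth g -> expgrowth g' ->
  gE (fun z => g z + g' z) = gE g + gE g'.
Proof.
by move=> /expgrowth_integrable ig /expgrowth_integrable ig'; exact: RintegralD.
Qed.

Lemma gEB g g' : expgrowth g -> expgrowth g' ->
  gE (fun z => g z - g' z) = gE g - gE g'.
Proof.
by move=> /expgrowth_integrable ig /expgrowth_integrable ig'; exact: RintegralB.
Qed.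

Lemma gEZ c g : expgrowth g -> gE (fun z => c * g z) = c * gE g.
Proof. by move=> /expgrowth_integrable ig; exact: RintegralZl. Qed.

Lemma le_gE g g' : expgrowth g -> expgrowth g' ->
  (forall z, g z <= g' z) -> gE g <= gE g'.
Proof.
move=> /expgrowth_integrable ig /expgrowth_integrable ig' gg'.
by apply: le_Rintegral => // z _; exact: gg'.
Qed.

Lemma gE_ge0 g : (forall z, 0 <= g z) -> 0 <= gE g.
Proof. by move=> g0; apply: Rintegral_ge0 => z _; exact: g0. Qed.

Lemma eq_gE g g' : g =1 g' -> gE g = gE g'.
Proof. by move=> /funext ->. Qed.

Lemma normr_gE g : expgrowth g -> `|gE g| <= gE (fun z => `|g z|).
Proof. by move=> /expgrowth_integrable ig; exact: le_normr_Rintegral. Qed.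

Lemma gEE g : gE g = fine (\int[gamma]_z (g z)%:E)%E.
Proof. by []. Qed.

(* Unification would otherwise unfold the integral when it compares expectations. *)
#[global] Opaque gE.

(** Jensen's inequality, by integrating the tangent line of the exponential at the
mean. *)
Lemma expR_gE g : expgrowth g -> expgrowth (fun z => expR (g z)) ->
  expR (gE g) <= gE (fun z => expR (g z)).
Proof.
move=> eg ee.
have -> : expR (gE g) = gE (fun z => expR (gE g) * (1 + (g z - gE g))).
  rewrite gEZ; last first.
    by apply: expgrowthD; [exact: expgrowth_cst|
      apply: expgrowthB => //; exact: expgrowth_cst].
  rewrite gED ?gEB ?gE_cst ?subrr ?addr0 ?mulr1//; try exact: expgrowth_cst.
  by apply: expgrowthB => //; exact: expgrowth_cst.
apply: le_gE => //.
  apply/expgrowthZ/expgrowthD; first exact: expgrowth_cst.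
  by apply: expgrowthB => //; exact: expgrowth_cst.
move=> z; rewrite -[in leRHS](subrKC (gE g) (g z)) expRD.
by rewrite ler_wpM2l ?expR_ge0// expR_ge1Dx.
Qed.

Lemma gE_expR_gt0 g : expgrowth g -> expgrowth (fun z => expR (g z)) ->
  0 < gE (fun z => expR (g z)).
Proof.
by move=> eg ee; apply: lt_le_trans (expR_gE eg ee); exact: expR_gt0.
Qed.

Lemma expgrowth_oppr g : expgrowth g -> expgrowth (fun z => g (- z)).
Proof.
move=> /(expgrowth_affine 0 (-1)).
by under eq_fun do rewrite add0r mulN1r.
Qed.

Lemma expgrowth_shift g c : expgrowth g -> expgrowth (fun z => g (z + c)).
Proof.
move=> /(expgrowth_affine c 1).
by under eq_fun do rewrite mul1r addrC.
Qed.

Lemma expgrowth_expR_linear c c' : expgrowth (fun z => expR (c * z + c')).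
Proof.
have /(lip_expgrowth_expR 1) : lip `|c| (fun z => c * z + c').
  move=> x y; rewrite (_ : c * x + c' - (c * y + c') = c * (x - y)); last by ring.
  by rewrite normrM.
by under eq_fun do rewrite mul1r.
Qed.

(** Reduces identities between linear functionals to nonnegative functions. *)
Lemma gE_normr_decomp w g : expgrowth w -> expgrowth g ->
  gE (fun z => g z * w z) =
  gE (fun z => (`|g z| + g z) * w z) - gE (fun z => `|g z| * w z).
Proof.
move=> ew eg; have ea := expgrowth_abs eg.
rewrite -gEB; last 2 first.
- by apply: expgrowthM => //; exact: expgrowthD.
- exact: expgrowthM.
by apply: eq_gE => z; ring.
Qed.

Lemma normrD_ge0 (x : R) : 0 <= `|x| + x.
Proof. by rewrite -lerBlDr sub0r -normrN ler_norm. Qed.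

Lemma gE_oppr g : expgrowth g -> gE (fun z => g (- z)) = gE g.
Proof.
have H h : expgrowth h -> (forall z, 0 <= h z) -> gE (fun z => h (- z)) = gE h.
  move=> eh h0; rewrite !gEE; congr fine.
  rewrite (ge0_integral_gauss_oppr (f := fun z => (h z)%:E))//.
  by apply/measurable_EFinP; exact: expgrowth_measurable.
move=> eg; have ea := expgrowth_abs eg.
transitivity (gE (fun z => `|g (- z)| + g (- z)) - gE (fun z => `|g (- z)|)).
  by rewrite (gED (expgrowth_oppr ea) (expgrowth_oppr eg)) addrAC subrr add0r.
rewrite (H (fun z => `|g z| + g z)) ?(H (fun z => `|g z|))//.
- by rewrite (gED ea eg) addrAC subrr add0r.
- exact: expgrowthD.
- by move=> z; exact: normrD_ge0.
Qed.

Lemma gE_shift c g : expgrowth g ->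
  gE (fun z => g (z + c)) = gE (fun z => g z * expR (c * z - c ^+ 2 / 2)).
Proof.
have H h : expgrowth h -> (forall z, 0 <= h z) ->
    gE (fun z => h (z + c)) = gE (fun z => h z * expR (c * z - c ^+ 2 / 2)).
  move=> eh h0; rewrite !gEE; congr fine.
  rewrite (ge0_integral_gauss_shift c (f := fun z => (h z)%:E))//.
  by apply/measurable_EFinP; exact: expgrowth_measurable.
move=> eg; have ea := expgrowth_abs eg.
rewrite gE_normr_decomp//; last exact: expgrowth_expR_linear.
rewrite -(H (fun z => `|g z| + g z)) -?(H (fun z => `|g z|))//.
- have := gED (expgrowth_shift c ea) (expgrowth_shift c eg).
  by move=> /= ->; rewrite addrAC subrr add0r.
- exact: expgrowthD.
- by move=> z; exact: normrD_ge0.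
Qed.

Lemma measurable_gE2 (F : R * R -> R) : measurable_fun setT F ->
  (forall p, 0 <= F p) -> measurable_fun setT (fun u => gE (fun v => F (u, v))).
Proof.
move=> mF F0; under eq_fun do rewrite gEE.
apply: (measurableT_comp (f := @fine R)) => //.
apply: (measurable_fun_fubini_tonelli_F (m2 := gamma) (EFin \o F)) => //=.
exact/measurable_EFinP.
Qed.

Lemma gE2E (F : R * R -> R) : (forall u, expgrowth (fun v => F (u, v))) ->
  gE (fun u => gE (fun v => F (u, v))) = fine (gauss2 (EFin \o F)).
Proof.
move=> eF; rewrite gEE /gauss2; congr fine.
by apply: eq_integral => u _; exact: EFin_gE.
Qed.

Lemma gE2_rotation (c s : R) (F : R * R -> R) :
  c ^+ 2 + s ^+ 2 = 1 -> s != 0 ->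
  measurable_fun setT F -> (forall p, 0 <= F p) ->
  (forall u, expgrowth (fun v => F (u, v))) ->
  (forall u, expgrowth (fun v => F (c * u + - s * v, s * u + c * v))) ->
  gE (fun u => gE (fun v => F (c * u + - s * v, s * u + c * v))) =
  gE (fun u => gE (fun v => F (u, v))).
Proof.
move=> cs s0 mF F0 eF eF'.
rewrite (gE2E eF) (gE2E (F := fun p => F (c * p.1 + - s * p.2, s * p.1 + c * p.2)) eF').
congr fine; apply: (gauss2_rotation (F := EFin \o F) cs s0).
  exact/measurable_EFinP.
by move=> p; rewrite lee_fin.
Qed.

(** The sum of independent Gaussian samples of variances [a] and [b] is Gaussian of
variance [a + b]: rotate the pair so that the sum becomes the first coordinate. *)
Lemma gE2_sqrtD a b g : 0 < a -> 0 < b -> expgrowth g -> (forall z, 0 <= g z) ->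
  gE (fun u => gE (fun v => g (Num.sqrt a * u + Num.sqrt b * v))) =
  gE (fun z => g (Num.sqrt (a + b) * z)).
Proof.
move=> a0 b0 eg g0.
have ab0 : 0 < a + b by rewrite addr_gt0.
have [sa sb sab] : [/\ 0 < Num.sqrt a, 0 < Num.sqrt b & 0 < Num.sqrt (a + b)].
  by rewrite !sqrtr_gt0.
(* Depends on the first coordinate only, so the inner expectation is trivial. *)
pose F (p : R * R) := g (Num.sqrt (a + b) * p.1).
have mg : measurable_fun setT g := expgrowth_measurable eg.
have mF : measurable_fun setT F.
  apply: measurableT_comp => //; apply: measurable_funM => //.
pose c := Num.sqrt a / Num.sqrt (a + b); pose s := - (Num.sqrt b / Num.sqrt (a + b)).
have rotE u v : Num.sqrt (a + b) * (c * u + - s * v) = Num.sqrt a * u + Num.sqrt b * v.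
  by rewrite /c /s; field; rewrite gt_eqF.
have cs : c ^+ 2 + s ^+ 2 = 1.
  rewrite /c /s sqrrN !expr_div_n !sqr_sqrtr ?ltW//; field; rewrite gt_eqF//.
have s0 : s != 0 by rewrite oppr_eq0 mulf_neq0// ?invr_eq0 gt_eqF.
transitivity (gE (fun u => gE (fun v => F (c * u + - s * v, s * u + c * v)))).
  by apply: eq_gE => u; apply: eq_gE => v; rewrite /F /= rotE.
rewrite gE2_rotation//.
- by apply: eq_gE => u; rewrite /F/= gE_cst.
- by move=> p; exact: g0.
- by move=> u; rewrite /F/=; exact: expgrowth_cst.
- move=> u; rewrite /F/=; under eq_fun do rewrite rotE; exact: expgrowth_affine.
Qed.

End GaussianExpectation.

(** * The one-step operator and its semigroup property *)

Section GaussStep.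
Context {R : realType}.
Local Notation gamma := (normal_prob (0 : R) 1).
Local Notation sqrt := Num.sqrt.
Implicit Types (f g : R -> R) (m h x y t c L : R).

Lemma gauss_step0E h f x : gauss_step 0 h f x = gE (fun z => f (x + sqrt h * z)).
Proof. by rewrite /gauss_step eqxx gEE unlock. Qed.

Lemma gauss_stepE m h f x : m != 0 ->
  gauss_step m h f x = m^-1 * ln (gE (fun z => expR (m * f (x + sqrt h * z)))).
Proof. by move=> /negbTE m0; rewrite /gauss_step m0 gEE unlock. Qed.

#[global] Opaque gauss_step.

Lemma lip_affine L f x r : lip L f -> lip (L * `|r|) (fun z => f (x + r * z)).
Proof.
move=> fL y z; apply: le_trans (fL _ _) _.
by rewrite -mulrA -normrM mulrBr [in leLHS]opprD addrACA subrr add0r.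
Qed.

Lemma expgrowth_sample L h f x : lip L f -> expgrowth (fun z => f (x + sqrt h * z)).
Proof. by move=> /(lip_affine x (sqrt h)); exact: lip_expgrowth. Qed.

Lemma expgrowth_expR_sample L m h f x : lip L f ->
  expgrowth (fun z => expR (m * f (x + sqrt h * z))).
Proof. by move=> /(lip_affine x (sqrt h)); exact: lip_expgrowth_expR. Qed.

Lemma expR_gauss_step L m h f x : lip L f -> m != 0 ->
  expR (m * gauss_step m h f x) = gE (fun z => expR (m * f (x + sqrt h * z))).
Proof.
move=> fL m0; rewrite gauss_stepE// mulrA divff// mul1r lnK// posrE.
apply: gE_expR_gt0; last exact: expgrowth_expR_sample fL.
exact/expgrowthZ/(expgrowth_sample _ _ fL).
Qed.

Lemma expR_convex t x y : 0 <= t <= 1 ->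
  expR (t * x + (1 - t) * y) <= t * expR x + (1 - t) * expR y.
Proof.
move=> /andP[t0 t1]; set p := t * x + _.
have tangent u : expR p * (1 + (u - p)) <= expR u.
  have -> : expR u = expR p * expR (u - p) by rewrite -expRD subrKC.
  by rewrite ler_wpM2l ?expR_ge0// expR_ge1Dx.
apply: (@le_trans _ _
  (t * (expR p * (1 + (x - p))) + (1 - t) * (expR p * (1 + (y - p))))).
  by rewrite le_eqVlt; apply/orP; left; apply/eqP; rewrite /p; ring.
by rewrite lerD// ler_wpM2l// subr_ge0.
Qed.

(** The operator is monotone, commutes with constants and with translations, and is
convex; this single inequality contains all four.  After normalization by the
values at [y1] and [y2] the convexity is that of the exponential, applied
pointwise. *)
Lemma gauss_step_convex_comb L m h f g1 g2 x y1 y2 t c :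
  lip L f -> lip L g1 -> lip L g2 -> 0 <= m -> 0 <= t <= 1 ->
  (forall z, f (x + sqrt h * z) <=
    t * g1 (y1 + sqrt h * z) + (1 - t) * g2 (y2 + sqrt h * z) + c) ->
  gauss_step m h f x <=
    t * gauss_step m h g1 y1 + (1 - t) * gauss_step m h g2 y2 + c.
Proof.
move=> fL g1L g2L; rewrite le_eqVlt => /predU1P[<-|m0] t01 fg.
  rewrite !gauss_step0E.
  have eg1 := expgrowth_sample h y1 g1L; have eg2 := expgrowth_sample h y2 g2L.
  rewrite -!gEZ// -gED; [|exact: expgrowthZ..].
  rewrite -[X in _ + X](gE_cst c) -gED; last 2 first.
  - by apply: expgrowthD; exact: expgrowthZ.
  - exact: expgrowth_cst.
  apply: le_gE fg; first exact: expgrowth_sample fL.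
  apply: expgrowthD; last exact: expgrowth_cst.
  by apply: expgrowthD; exact: expgrowthZ.
have mN0 : m != 0 by rewrite gt_eqF.
rewrite -(ler_pM2l m0) -ler_expR (expR_gauss_step _ _ fL)//.
have normalize (C s p q : R) : C =
    C * (s * expR (- p)) * expR p + C * ((1 - s) * expR (- q)) * expR q.
  rewrite -2!(mulrA C) -2!(mulrA _ (expR _)) -!expRD !addNr expR0; ring.
set a := gauss_step m h g1 y1; set b := gauss_step m h g2 y2.
set C := expR (m * _).
have eg1 := expgrowth_expR_sample m h y1 g1L.
have eg2 := expgrowth_expR_sample m h y2 g2L.
have -> : C = gE (fun z =>
    C * (t * expR (- (m * a))) * expR (m * g1 (y1 + sqrt h * z)) +
    C * ((1 - t) * expR (- (m * b))) * expR (m * g2 (y2 + sqrt h * z))).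
  rewrite gED ?gEZ//; [|exact: expgrowthZ..].
  by rewrite -(expR_gauss_step _ _ g1L)// -(expR_gauss_step _ _ g2L)// -normalize.
apply: le_gE.
- exact: expgrowth_expR_sample fL.
- by apply: expgrowthD; exact: expgrowthZ.
move=> z; set u := g1 _; set v := g2 _.
apply: (@le_trans _ _ (C * expR (t * (m * (u - a)) + (1 - t) * (m * (v - b))))).
  rewrite -expRD ler_expR.
  have := fg z; rewrite -(ler_pM2l m0) => /le_trans; apply.
  rewrite le_eqVlt; apply/orP; left; apply/eqP; rewrite -/u -/v; ring.
have C0 : 0 <= C by exact: expR_ge0.
clearbody C a b u v.
apply: (@le_trans _ _ (C * (t * expR (m * (u - a)) + (1 - t) * expR (m * (v - b))))).
  exact: (ler_wpM2l C0 (expR_convex _ _ t01)).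
rewrite !(mulrBr m) !expRD le_eqVlt; apply/orP; left; apply/eqP; ring.
Qed.

Lemma le_gauss_step L m h f g x y c : lip L f -> lip L g -> 0 <= m ->
  (forall z, f (x + sqrt h * z) <= g (y + sqrt h * z) + c) ->
  gauss_step m h f x <= gauss_step m h g y + c.
Proof.
move=> fL gL m0 fg.
have := @gauss_step_convex_comb L m h f g g x y y 1 c fL gL gL m0.
rewrite ler01 lexx/= mul1r subrr mul0r addr0; apply => // z.
by rewrite mul1r mul0r addr0.
Qed.

Lemma lip_gauss_step L m h f : lip L f -> 0 <= m -> lip L (gauss_step m h f).
Proof.
move=> fL m0 x y.
have H u v : gauss_step m h f u - gauss_step m h f v <= L * `|u - v|.
  rewrite lerBlDl; apply: (le_gauss_step fL fL) => // z.
  rewrite -lerBlDl; apply: le_trans (ler_norm _) _.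
  apply: le_trans (fL _ _) _.
  by rewrite [in leLHS]opprD addrACA subrr addr0.
by rewrite ler_norml H andbT lerNl opprB distrC H.
Qed.

Lemma dist_gauss_step L m h f g c : lip L f -> lip L g -> 0 <= m ->
  (forall z, `|f z - g z| <= c) ->
  forall x, `|gauss_step m h f x - gauss_step m h g x| <= c.
Proof.
move=> fL gL m0 fg x; rewrite ler_norml; apply/andP; split.
  rewrite lerNl opprB lerBlDl; apply: (le_gauss_step gL fL) => // z.
  by rewrite -lerBlDl; apply: le_trans (fg (x + sqrt h * z)); rewrite distrC ler_norm.
rewrite lerBlDl; apply: (le_gauss_step fL gL) => // z.
by rewrite -lerBlDl; apply: le_trans (fg (x + sqrt h * z)); rewrite ler_norm.
Qed.

Definition cvx f : Prop := forall t x y, 0 <= t <= 1 ->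
  f (t * x + (1 - t) * y) <= t * f x + (1 - t) * f y.

Lemma cvx_gauss_step L m h f : lip L f -> 0 <= m -> cvx f ->
  cvx (gauss_step m h f).
Proof.
move=> fL m0 fc t x y t01.
rewrite -[leRHS]addr0.
apply: (gauss_step_convex_comb (c := 0) fL fL fL) => // z.
rewrite addr0; apply: le_trans (fc _ _ _ t01).
rewrite le_eqVlt; apply/orP; left; apply/eqP; congr f; ring.
Qed.

Lemma lip_gE L f r s : lip L f ->
  lip (L * `|r|) (fun u => gE (fun v => f (r * u + s * v))).
Proof.
move=> fL x y; have L0 := lip_ge0 fL.
have ef u : expgrowth (fun v => f (r * u + s * v)).
  exact: lip_expgrowth (lip_affine _ _ fL).
rewrite -gEB//; apply: le_trans (normr_gE _) _; first exact: expgrowthB.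
rewrite -[leRHS]gE_cst; apply: le_gE.
- exact/expgrowth_abs/expgrowthB.
- exact: expgrowth_cst.
move=> z; apply: le_trans (fL _ _) _.
by rewrite -mulrA -normrM opprD addrACA subrr addr0 mulrBr.
Qed.

Lemma lipD L L' f g : lip L f -> lip L' g -> lip (L + L') (fun z => f z + g z).
Proof.
move=> fL gL x y; rewrite opprD addrACA mulrDl.
by apply: le_trans (ler_normD _ _) _; exact: lerD.
Qed.

Lemma lip_norm L f : lip L f -> lip L (fun z => `|f z|).
Proof. by move=> fL x y; apply: le_trans (ler_dist_dist _ _) _. Qed.

(** [f] is the difference of the nonnegative functions |f| + f and |f|, which are
Lipschitz as well. *)
Lemma gE2_sqrtD_lip L a b f : 0 < a -> 0 < b -> lip L f ->
  gE (fun u => gE (fun v => f (sqrt a * u + sqrt b * v))) =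
  gE (fun z => f (sqrt (a + b) * z)).
Proof.
move=> a0 b0 fL.
have faL := lip_norm fL.
have fpL := lipD faL fL.
have einner L' g u : lip L' g -> expgrowth (fun v => g (sqrt a * u + sqrt b * v)).
  by move=> gL; exact: lip_expgrowth (lip_affine _ _ gL).
have eouter L' g : lip L' g ->
    expgrowth (fun u => gE (fun v => g (sqrt a * u + sqrt b * v))).
  by move=> gL; exact: lip_expgrowth (lip_gE _ _ gL).
have es L' g : lip L' g -> expgrowth (fun z => g (sqrt (a + b) * z)).
  by move=> /(lip_affine 0 (sqrt (a + b)))/lip_expgrowth; under eq_fun do rewrite add0r.
have H L' g : lip L' g -> (forall z, 0 <= g z) ->
    gE (fun u => gE (fun v => g (sqrt a * u + sqrt b * v))) =
    gE (fun z => g (sqrt (a + b) * z)).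
  by move=> gL g0; apply: gE2_sqrtD => //; exact: lip_expgrowth gL.
have := H _ _ fpL (fun z => normrD_ge0 (f z)).
rewrite [in RHS]gED//; [|exact: es faL|exact: es fL].
under eq_gE.
  move=> u; rewrite (gED (einner _ _ u faL) (einner _ _ u fL)); over.
rewrite gED//; [|exact: eouter faL|exact: eouter fL].
by rewrite (H _ _ faL)// => /addrI.
Qed.

Lemma gauss_step_semigroup L m a b f x : lip L f -> 0 <= m -> 0 < a -> 0 < b ->
  gauss_step m a (gauss_step m b f) x = gauss_step m (a + b) f x.
Proof.
move=> fL m_ge0 a0 b0.
have fxL := lip_affine x 1 fL.
have [->|m0] := eqVneq m 0.
  rewrite !gauss_step0E.
  under eq_gE do rewrite gauss_step0E.
  transitivity (gE (fun u => gE (fun v => f (x + 1 * (sqrt a * u + sqrt b * v))))).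
    by apply: eq_gE => u; apply: eq_gE => v; rewrite mul1r addrA.
  by rewrite (gE2_sqrtD_lip a0 b0 fxL); apply: eq_gE => z; rewrite mul1r.
rewrite (gauss_stepE _ _ _ m0) [RHS](gauss_stepE _ _ _ m0).
under eq_gE do rewrite (expR_gauss_step _ _ fL)//.
congr (_ * ln _).
pose g z := expR (m * f (x + 1 * z)).
transitivity (gE (fun u => gE (fun v => g (sqrt a * u + sqrt b * v)))).
  by apply: eq_gE => u; apply: eq_gE => v; rewrite /g mul1r addrA.
rewrite gE2_sqrtD//; first by apply: eq_gE => z; rewrite /g mul1r.
- exact: lip_expgrowth_expR fxL.
- by move=> z; exact: expR_ge0.
Qed.

End GaussStep.

(** * Total positivity: monotonicity of differences for a common parameter *)

Section OrderPreservation.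
Context {R : realType}.
Local Notation sqrt := Num.sqrt.
Implicit Types (f g : R -> R) (m h x y t c e L : R) (b : bool).

(** The quantity along which functions are monotone: [x] itself ([b = false], the
monotone case) or |x| ([b = true], the even case).  A function that is monotone
in |x| is even ([monob_even]), so no separate parity hypothesis is needed. *)
Definition ord b x : R := if b then `|x| else x.

(** The slack [e] absorbs the errors accumulated over many short steps. *)
Definition monob b f e : Prop := forall x y, ord b x <= ord b y -> f x <= f y + e.

(** The x-dependent factor of the Gaussian density centred at x, averaged over the
sign of [z] in the even case ([gE_kernel]). *)
Definition kernel b c z : R :=
  if b then (expR (c * z) + expR (- (c * z))) / 2 else expR (c * z).

Lemma expgrowth_expR_mul c : expgrowth (fun z : R => expR (c * z)).
Proof. by have := expgrowth_expR_linear c 0; under eq_fun do rewrite addr0. Qed.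

Lemma expgrowth_kernel b c : expgrowth (kernel b c).
Proof.
rewrite /kernel; case: b; last exact: expgrowth_expR_mul.
under eq_fun do rewrite mulrC -mulNr.
by apply/expgrowthZ/expgrowthD; exact: expgrowth_expR_mul.
Qed.

Lemma kernel_gt0 b c z : 0 < kernel b c z.
Proof. by case: b; rewrite /kernel ?divr_gt0 ?addr_gt0 ?expR_gt0. Qed.

(** The difference of the two sides is (e^s - e^t) (1 - e^(-s-t)), whose factors have
the signs of s - t and s + t. *)
Lemma cosh_le (s t : R) : t ^+ 2 <= s ^+ 2 ->
  expR t + expR (- t) <= expR s + expR (- s).
Proof.
rewrite -subr_ge0 subr_sqr => st.
suff : 0 <= (expR s - expR t) * (1 - expR (- (s + t))).
  rewrite mulrBr mulr1 mulrBl -!expRD.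
  have -> : s - (s + t) = - t by ring.
  have -> : t - (s + t) = - s by ring.
  lra.
have [st0|st0|st0] := ltgtP s t.
- have st1 : s + t <= 0.
    by rewrite leNgt; apply/negP => h; move: st; rewrite nmulr_rge0 ?subr_lt0// leNgt h.
  rewrite mulr_le0// ?subr_le0 ?ler_expR ?(ltW st0)//.
  by rewrite -[leLHS](expR0 R) ler_expR oppr_ge0.
- have st1 : 0 <= s + t by move: st; rewrite pmulr_rge0 ?subr_gt0.
  rewrite mulr_ge0// ?subr_ge0 ?ler_expR ?(ltW st0)//.
  by rewrite -[leRHS](expR0 R) ler_expR oppr_le0.
- by rewrite st0 subrr mul0r.
Qed.

(** Total positivity of order two.  In the even case the products of hyperbolic
cosines become sums, and each cosine is compared through the square of its
argument; both times the squares differ by (c'^2 - c^2) (z^2 - z'^2). *)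
Lemma kernel_TP2 b c c' z z' : ord b c <= ord b c' -> ord b z' <= ord b z ->
  kernel b c z * kernel b c' z' <= kernel b c' z * kernel b c z'.
Proof.
case: b => /= cc zz; rewrite /kernel; last first.
  rewrite -!expRD ler_expR.
  have : 0 <= (c' - c) * (z - z') by rewrite mulr_ge0 ?subr_ge0.
  lra.
have sqr_le (p q : R) : `|p| <= `|q| -> p ^+ 2 <= q ^+ 2.
  by move=> pq; rewrite -(real_normK (num_real p)) -(real_normK (num_real q))
    ler_sqr ?nnegrE.
have c2 := sqr_le _ _ cc; have z2 := sqr_le _ _ zz.
have sq : 0 <= (c' ^+ 2 - c ^+ 2) * (z ^+ 2 - z' ^+ 2) by rewrite mulr_ge0 ?subr_ge0.
have H1 : expR (c * z + c' * z') + expR (- (c * z + c' * z')) <=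
    expR (c' * z + c * z') + expR (- (c' * z + c * z')).
  apply: cosh_le; rewrite -subr_ge0.
  by rewrite (_ : _ - _ = (c' ^+ 2 - c ^+ 2) * (z ^+ 2 - z' ^+ 2))//; ring.
have H2 : expR (c * z - c' * z') + expR (- (c * z - c' * z')) <=
    expR (c' * z - c * z') + expR (- (c' * z - c * z')).
  apply: cosh_le; rewrite -subr_ge0.
  by rewrite (_ : _ - _ = (c' ^+ 2 - c ^+ 2) * (z ^+ 2 - z' ^+ 2))//; ring.
have prodE (p q : R) : (expR p + expR (- p)) / 2 * ((expR q + expR (- q)) / 2) =
   ((expR (p + q) + expR (- (p + q))) + (expR (p - q) + expR (- (p - q)))) / 4.
  by rewrite !opprD opprK !expRD; field.
by rewrite !prodE ler_pM2r ?invr_gt0// lerD.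
Qed.

(** Moves the dependence on the centre [x] from the sample to the weight [kernel];
the remaining factor does not depend on the function. *)
Lemma gE_kernel b g h x : 0 < h -> expgrowth (fun z => g (sqrt h * z)) ->
  (b -> forall z, g (- z) = g z) ->
  gE (fun z => g (x + sqrt h * z)) =
  expR (- (x / sqrt h) ^+ 2 / 2) *
  gE (fun z => g (sqrt h * z) * kernel b (x / sqrt h) z).
Proof.
move=> h0 eg geven.
have r0 : sqrt h != 0 by rewrite gt_eqF// sqrtr_gt0.
set c := x / sqrt h.
have -> : gE (fun z => g (x + sqrt h * z)) =
    expR (- c ^+ 2 / 2) * gE (fun z => g (sqrt h * z) * expR (c * z)).
  rewrite -gEZ; last by apply: expgrowthM => //; exact: expgrowth_expR_mul.
  transitivity (gE (fun z => g (sqrt h * (z + c)))).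
    by apply: eq_gE => z; rewrite mulrDr [sqrt h * c]mulrC divfK// addrC.
  rewrite (gE_shift c eg); apply: eq_gE => z.
  by rewrite mulrCA -expRD; congr (_ * expR _); lra.
congr (_ * _); case: b geven => // /(_ isT) geven; rewrite /kernel.
have e1 : expgrowth (fun z => g (sqrt h * z) * expR (c * z)).
  by apply: expgrowthM => //; exact: expgrowth_expR_mul.
have e2 : expgrowth (fun z => g (sqrt h * z) * expR (- (c * z))).
  under eq_fun do rewrite -mulNr.
  by apply: expgrowthM => //; exact: expgrowth_expR_mul.
have oppE : gE (fun z => g (sqrt h * z) * expR (- (c * z))) =
    gE (fun z => g (sqrt h * z) * expR (c * z)).
  rewrite -(gE_oppr e1); apply: eq_gE => z.
  by rewrite !mulrN geven.
transitivity (2^-1 * (gE (fun z => g (sqrt h * z) * expR (c * z)) +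
    gE (fun z => g (sqrt h * z) * expR (- (c * z))))).
  by rewrite oppE; field.
rewrite -gED// -gEZ; last exact: expgrowthD.
by apply: eq_gE => z; field.
Qed.

#[global] Opaque kernel.

Lemma gE_lin4 (g1 g2 g3 g4 : R -> R) k1 k2 k3 k4 : 
  expgrowth g1 -> expgrowth g2 -> expgrowth g3 -> expgrowth g4 ->
  expgrowth (fun z => k1 * g1 z + k2 * g2 z + (k3 * g3 z + k4 * g4 z)) /\
  gE (fun z => k1 * g1 z + k2 * g2 z + (k3 * g3 z + k4 * g4 z)) =
  k1 * gE g1 + k2 * gE g2 + (k3 * gE g3 + k4 * gE g4).
Proof.
move=> e1 e2 e3 e4.
have e12 : expgrowth (fun z => k1 * g1 z + k2 * g2 z).
  by apply: expgrowthD; exact: expgrowthZ.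
have e34 : expgrowth (fun z => k3 * g3 z + k4 * g4 z).
  by apply: expgrowthD; exact: expgrowthZ.
split; first exact: expgrowthD.
rewrite (gED e12 e34) (gED (expgrowthZ k1 e1) (expgrowthZ k2 e2)).
by rewrite (gED (expgrowthZ k3 e3) (expgrowthZ k4 e4)) !gEZ.
Qed.

(** Chebyshev's association argument: an inequality between products of expectations
follows from a pointwise inequality symmetrized over two independent samples. *)
Lemma gE2_antisym (p1 p2 q1 q2 r1 r2 : R -> R) k e :
  expgrowth p1 -> expgrowth p2 -> expgrowth q1 -> expgrowth q2 ->
  expgrowth r1 -> expgrowth r2 ->
  (forall u v, q1 u * q2 v + q1 v * q2 u <=
     k * (p1 u * p2 v + p1 v * p2 u) + e * (r1 u * r2 v + r1 v * r2 u)) ->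
  gE q1 * gE q2 <= k * (gE p1 * gE p2) + e * (gE r1 * gE r2).
Proof.
move=> ep1 ep2 eq1 eq2 er1 er2 H.
have e0 : expgrowth (fun=> 0 : R) by exact: expgrowth_cst.
have in1 u : q1 u * gE q2 + q2 u * gE q1 <=
    k * (p1 u * gE p2 + p2 u * gE p1) + e * (r1 u * gE r2 + r2 u * gE r1).
  have [eL EL] := gE_lin4 (q1 u) (q2 u) 0 0 eq2 eq1 e0 e0.
  have [eR ER] := gE_lin4 (k * p1 u) (k * p2 u) (e * r1 u) (e * r2 u) ep2 ep1 er2 er1.
  have H2 v : q1 u * q2 v + q2 u * q1 v + (0 * 0 + 0 * 0) <=
    k * p1 u * p2 v + k * p2 u * p1 v + (e * r1 u * r2 v + e * r2 u * r1 v).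
    by have := H u v; lra.
  have := le_gE eL eR H2; rewrite EL ER; lra.
have [eL EL] := gE_lin4 (gE q2) (gE q1) 0 0 eq1 eq2 e0 e0.
have [eR ER] := gE_lin4 (k * gE p2) (k * gE p1) (e * gE r2) (e * gE r1) ep1 ep2 er1 er2.
have H2 u : gE q2 * q1 u + gE q1 * q2 u + (0 * 0 + 0 * 0) <=
  k * gE p2 * p1 u + k * gE p1 * p2 u + (e * gE r2 * r1 u + e * gE r1 * r2 u).
  by have := in1 u; lra.
have := le_gE eL eR H2; rewrite EL ER; lra.
Qed.

Lemma monob_even f : monob true f 0 -> forall z, f (- z) = f z.
Proof.
move=> fm z; apply/eqP; rewrite eq_le.
by have := fm (- z) z; have := fm z (- z); rewrite /ord normrN lexx !addr0 => -> // -> //.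
Qed.

Lemma ordZ b c z z' : 0 <= c -> ord b z <= ord b z' -> ord b (c * z) <= ord b (c * z').
Proof. by case: b => c0 /= zz; rewrite /ord ?normrM ler_wpM2l. Qed.

Lemma ordV b c z z' : 0 < c -> ord b z <= ord b z' -> ord b (z / c) <= ord b (z' / c).
Proof. by move=> c0; rewrite ![_ / c]mulrC; apply: ordZ; rewrite invr_ge0 ltW. Qed.

Lemma ord_total b z z' : (ord b z <= ord b z') || (ord b z' <= ord b z).
Proof. exact: le_total. Qed.

Lemma chebyshev_add (p q A B e : R) : 0 <= e -> 0 < A -> A <= B ->
  q <= p + e -> p * A + q * B <= p * B + q * A + e * (A + B).
Proof.
move=> e0 A0 AB qp; rewrite -subr_ge0.
rewrite (_ : _ - _ = (p + e - q) * (B - A) + 2 * (e * A)); last by ring.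
by rewrite addr_ge0// mulr_ge0 ?subr_ge0// mulr_ge0// ltW.
Qed.

Lemma chebyshev_mul (P Q A B k : R) : 1 <= k -> 0 < A -> 0 < P -> 0 < Q ->
  A <= B -> Q <= k * P -> P * A + Q * B <= k * (P * B + Q * A).
Proof.
move=> k1 A0 P0 Q0 AB QP; rewrite -subr_ge0.
rewrite (_ : _ - _ = (k * P - Q) * (B - A) + A * ((k - 1) * (P + Q))); last by ring.
rewrite addr_ge0// mulr_ge0 ?subr_ge0// ?(ltW A0)//.
by rewrite mulr_ge0 ?subr_ge0// addr_ge0// ltW.
Qed.

(** In terms of [gE_kernel] this is a statement on expectations weighted by the
kernels at [x] and [x'].  The ratio of these kernels is monotone, and so is, up to
the slack, the ratio of the exponentials of m f2 and m f1 (for m = 0, the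
difference of f2 and f1); Chebyshev's argument combines the two. *)
Lemma monob_gauss_step L b m h f1 f2 e : 0 < h -> 0 <= m -> 0 <= e ->
  lip L f1 -> lip L f2 -> monob b f1 0 -> monob b f2 0 ->
  monob b (fun x => f2 x - f1 x) e ->
  monob b (fun x => gauss_step m h f2 x - gauss_step m h f1 x) e.
Proof.
move=> h0 m_ge0 e0 f1L f2L f1m f2m f21 x x' xx'.
have r0 : 0 < sqrt h by rewrite sqrtr_gt0.
have even f : monob b f 0 -> b -> forall z, f (- z) = f z.
  by move=> fm bT; apply: monob_even; rewrite bT in fm.
set c := x / sqrt h; set c' := x' / sqrt h.
have cc' : ord b c <= ord b c' by exact: ordV.
have ek := expgrowth_kernel b.
pose w := expR (- c ^+ 2 / 2); pose w' := expR (- c' ^+ 2 / 2).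
have w0 : 0 < w by exact: expR_gt0.
have w'0 : 0 < w' by exact: expR_gt0.
have es f : lip L f -> expgrowth (fun z => f (sqrt h * z)).
  by move=> fL; have := expgrowth_sample h 0 fL; under eq_fun do rewrite add0r.
have es1 := es _ f1L; have es2 := es _ f2L.
move: m_ge0; rewrite le_eqVlt => /predU1P[<-|m0].
  rewrite !gauss_step0E !(gE_kernel (b := b) _ h0)//; try exact: even.
  rewrite -/c -/c' -/w -/w'.
  have E1 : 1 = w * gE (kernel b c).
    have := @gE_kernel b (fun=> 1) h x h0 (expgrowth_cst _) (fun _ _ => erefl).
    by rewrite gE_cst => ->; congr (_ * _); apply: eq_gE => z; rewrite mul1r.
  have E1' : 1 = w' * gE (kernel b c').
    have := @gE_kernel b (fun=> 1) h x' h0 (expgrowth_cst _) (fun _ _ => erefl).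
    by rewrite gE_cst => ->; congr (_ * _); apply: eq_gE => z; rewrite mul1r.
  pose D z := f2 (sqrt h * z) - f1 (sqrt h * z).
  have eD : expgrowth D by exact: expgrowthB.
  have Dm u v : ord b v <= ord b u -> D v <= D u + e.
    by move=> vu; apply: f21; apply: ordZ => //; exact: ltW.
  have ED k : gE (fun z => D z * kernel b k z) =
      gE (fun z => f2 (sqrt h * z) * kernel b k z) -
      gE (fun z => f1 (sqrt h * z) * kernel b k z).
    rewrite -gEB; [|exact: expgrowthM..].
    by apply: eq_gE => z; rewrite /D mulrBl.
  rewrite -!mulrBr -!ED.
  have H := @gE2_antisym (fun z => D z * kernel b c' z) (kernel b c)
    (fun z => D z * kernel b c z) (kernel b c') (kernel b c') (kernel b c) 1 e
    (expgrowthM eD (ek c')) (ek c) (expgrowthM eD (ek c)) (ek c') (ek c') (ek c).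
  have {}H : gE (fun z => D z * kernel b c z) * gE (kernel b c') <=
      gE (fun z => D z * kernel b c' z) * gE (kernel b c) +
      e * (gE (kernel b c') * gE (kernel b c)).
    apply: le_trans (H _) _; last by rewrite mul1r.
    move=> u v; rewrite mul1r.
    have K0 y z : 0 < kernel b c y * kernel b c' z by rewrite mulr_gt0 ?kernel_gt0.
    case/orP: (ord_total b v u) => uv.
      have := chebyshev_add e0 (K0 u v) (kernel_TP2 cc' uv) (Dm _ _ uv).
      move: (D u) (D v) (kernel b c u) (kernel b c' u) (kernel b c v) (kernel b c' v).
      by move=> ? ? ? ? ? ? H'; lra.
    have := chebyshev_add e0 (K0 v u) (kernel_TP2 cc' uv) (Dm _ _ uv).
    move: (D u) (D v) (kernel b c u) (kernel b c' u) (kernel b c v) (kernel b c' v).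
    by move=> ? ? ? ? ? ? H'; lra.
  have ww0 : 0 <= w * w' by rewrite mulr_ge0// ltW.
  have := ler_wpM2l ww0 H.
  set X := gE (fun z => D z * kernel b c z); set X' := gE (fun z => D z * kernel b c' z).
  rewrite (_ : w * w' * (X * gE (kernel b c')) =
    w * X * (w' * gE (kernel b c'))); last by ring.
  rewrite (_ : w * w' * _ = w' * X' * (w * gE (kernel b c)) +
    e * (w * gE (kernel b c)) * (w' * gE (kernel b c'))); last by ring.
  by rewrite -E1 -E1' !mulr1.
have mN0 : m != 0 by rewrite gt_eqF.
pose G f z := expR (m * f (sqrt h * z)).
have eG f : lip L f -> expgrowth (G f).
  by move=> fL; have := expgrowth_expR_sample m h 0 fL; under eq_fun do rewrite add0r.
have EG f y : lip L f -> monob b f 0 -> expR (m * gauss_step m h f y) =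
    expR (- (y / sqrt h) ^+ 2 / 2) * gE (fun z => G f z * kernel b (y / sqrt h) z).
  move=> fL fm; rewrite (expR_gauss_step _ _ fL)//.
  apply: (@gE_kernel b (fun z => expR (m * f z))) => //; first exact: eG.
  by move=> bT z; rewrite (even f).
suff : m * gauss_step m h f2 x + m * gauss_step m h f1 x' <=
    m * e + (m * gauss_step m h f2 x' + m * gauss_step m h f1 x).
  by rewrite -!mulrDr ler_pM2l//; lra.
rewrite -ler_expR !expRD !EG// -/c -/c' -/w -/w'.
pose k := expR (m * e); rewrite -/k.
have k1 : 1 <= k by rewrite -[leLHS](expR0 R) ler_expR mulr_ge0// ltW.
have G0 f z : 0 < G f z by exact: expR_gt0.
have H : gE (fun z => G f2 z * kernel b c z) * gE (fun z => G f1 z * kernel b c' z) <=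
    k * (gE (fun z => G f2 z * kernel b c' z) * gE (fun z => G f1 z * kernel b c z)) +
    0 * (gE (fun=> 1) * gE (fun=> 1)).
  apply: gE2_antisym; try exact: (expgrowth_cst 1);
    try exact: (expgrowthM (eG _ _) (ek _)).
  have QP u v : ord b v <= ord b u -> G f2 v * G f1 u <= k * (G f2 u * G f1 v).
    move=> vu; rewrite /G /k -!expRD ler_expR -!mulrDr ler_pM2l//.
    have : ord b (sqrt h * v) <= ord b (sqrt h * u) by apply: ordZ => //; exact: ltW.
    by move/f21; lra.
  have K0 y z : 0 < kernel b c y * kernel b c' z by rewrite mulr_gt0 ?kernel_gt0.
  move=> u v; have G12 y z : 0 < G f2 y * G f1 z by rewrite mulr_gt0.
  clearbody k.
  case/orP: (ord_total b v u) => uv.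
    have := chebyshev_mul k1 (K0 u v) (G12 u v) (G12 v u) (kernel_TP2 cc' uv) (QP _ _ uv).
    move: (G f1 u) (G f1 v) (G f2 u) (G f2 v).
    move: (kernel b c u) (kernel b c' u) (kernel b c v) (kernel b c' v).
    by move=> ? ? ? ? ? ? ? ? H; lra.
  have := chebyshev_mul k1 (K0 v u) (G12 v u) (G12 u v) (kernel_TP2 cc' uv) (QP _ _ uv).
  move: (G f1 u) (G f1 v) (G f2 u) (G f2 v).
  move: (kernel b c u) (kernel b c' u) (kernel b c v) (kernel b c' v).
  by move=> ? ? ? ? ? ? ? ? H; lra.
have ww0 : 0 <= w * w' by rewrite mulr_ge0// ltW.
have := ler_wpM2l ww0 H; rewrite mul0r addr0.
move: (gE _) (gE _) (gE _) (gE _) => X1 X2 X3 X4.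
clearbody k w w'.
by clear; move=> H; lra.
Qed.

End OrderPreservation.

(** * Variances of samples *)

Section Variance.
Context {R : realType}.
Local Notation sqrt := Num.sqrt.
Implicit Types (f g F : R -> R) (m h x y t c e L : R) (b : bool).

Definition var F : R := gE (fun z => F z ^+ 2) - (gE F) ^+ 2.

Lemma gE_sqr_dist F a : expgrowth F ->
  expgrowth (fun v => (a - F v) ^+ 2) /\
  gE (fun v => (a - F v) ^+ 2) = a ^+ 2 - 2 * a * gE F + gE (fun z => F z ^+ 2).
Proof.
move=> eF.
have e1 : expgrowth (fun=> 1 : R) by exact: expgrowth_cst.
have [eL EL] := gE_lin4 (a ^+ 2) (- (2 * a)) 1 0 e1 eF (expgrowthX 2 eF) e1.
have HE : (fun v => (a - F v) ^+ 2) =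
  (fun z => a ^+ 2 * 1 + - (2 * a) * F z + (1 * F z ^+ 2 + 0 * 1)).
  by apply/funext => v; ring.
by rewrite HE; split=> //; rewrite EL gE_cst; ring.
Qed.

(** The variance is half the mean square distance of two independent samples. *)
Lemma gE2_sqr_dist F : expgrowth F ->
  expgrowth (fun u => gE (fun v => (F u - F v) ^+ 2)) /\
  gE (fun u => gE (fun v => (F u - F v) ^+ 2)) = 2 * var F.
Proof.
move=> eF.
have e1 : expgrowth (fun=> 1 : R) by exact: expgrowth_cst.
have [eL EL] := gE_lin4 1 (- (2 * gE F)) (gE (fun z => F z ^+ 2)) 0
  (expgrowthX 2 eF) eF e1 e1.
have HE : (fun u => gE (fun v => (F u - F v) ^+ 2)) = (fun z =>
    1 * F z ^+ 2 + - (2 * gE F) * F z + (gE (fun z => F z ^+ 2) * 1 + 0 * 1)).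
  by apply/funext => u; rewrite (gE_sqr_dist (F u) eF).2; ring.
by rewrite HE; split=> //; rewrite EL gE_cst /var; ring.
Qed.

Lemma var_center F : expgrowth F -> var F = gE (fun z => (F z - gE F) ^+ 2).
Proof.
move=> eF.
transitivity (gE (fun z => (gE F - F z) ^+ 2)).
  by rewrite (gE_sqr_dist (gE F) eF).2 /var; ring.
by apply: eq_gE => z; rewrite -sqrrN opprB.
Qed.

(** Writing the variances over two independent samples, this is the pointwise
inequality m (t p + (1-t) q)^2 <= t m1 p^2 + (1-t) m2 q^2 for p^2 <= q^2. *)
Lemma var_convex_comb F1 F2 m1 m2 t : expgrowth F1 -> expgrowth F2 ->
  0 <= m1 -> m1 <= m2 -> 0 <= t <= 1 ->
  (forall u v, `|F1 u - F1 v| <= `|F2 u - F2 v|) ->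
  (t * m1 + (1 - t) * m2) * var (fun z => t * F1 z + (1 - t) * F2 z) <=
  t * m1 * var F1 + (1 - t) * m2 * var F2.
Proof.
move=> e1 e2 m10 m12 /andP[t0 t1] F12.
set m := _ + _; set F := (fun z => _ + _).
have eF : expgrowth F by apply: expgrowthD; exact: expgrowthZ.
have [E1 V1] := gE2_sqr_dist e1; have [E2 V2] := gE2_sqr_dist e2.
have [E V] := gE2_sqr_dist eF.
have pw u v : m * (F u - F v) ^+ 2 <=
    t * m1 * (F1 u - F1 v) ^+ 2 + (1 - t) * m2 * (F2 u - F2 v) ^+ 2.
  have := F12 u v; rewrite -ler_sqr ?nnegrE// !real_normK ?num_real//.
  rewrite /F (_ : t * F1 u + (1 - t) * F2 u - (t * F1 v + (1 - t) * F2 v) =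
    t * (F1 u - F1 v) + (1 - t) * (F2 u - F2 v)); last by ring.
  move: (F1 u - F1 v) (F2 u - F2 v) => p q pq.
  rewrite -subr_ge0 /m.
  (* A sum of nonnegative terms, since m1 <= m2 and p^2 <= q^2. *)
  rewrite (_ : _ - _ = t * (1 - t) * ((m2 - m1) * (q ^+ 2 - p ^+ 2) +
     (t * m1 + (1 - t) * m2) * (p - q) ^+ 2)); last by ring.
  have m20 : 0 <= m2 by exact: le_trans m12.
  have t1' : 0 <= 1 - t by rewrite subr_ge0.
  apply: mulr_ge0; first exact: mulr_ge0.
  apply: addr_ge0; first by rewrite mulr_ge0// subr_ge0.
  by apply: mulr_ge0; [apply: addr_ge0; exact: mulr_ge0|exact: sqr_ge0].
have e0 : expgrowth (fun=> 0 : R) by exact: expgrowth_cst.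
have inner u : m * gE (fun v => (F u - F v) ^+ 2) <=
    t * m1 * gE (fun v => (F1 u - F1 v) ^+ 2) +
    (1 - t) * m2 * gE (fun v => (F2 u - F2 v) ^+ 2).
  have [eu _] := gE_sqr_dist (F u) eF.
  have [eu1 _] := gE_sqr_dist (F1 u) e1.
  have [eu2 _] := gE_sqr_dist (F2 u) e2.
  rewrite -!gEZ// -gED; [|exact: expgrowthZ..].
  by apply: le_gE (pw u); [exact: expgrowthZ|apply: expgrowthD; exact: expgrowthZ].
have := le_gE (expgrowthZ m E)
  (expgrowthD (expgrowthZ (t * m1) E1) (expgrowthZ ((1 - t) * m2) E2)) inner.
rewrite gED; [|exact: expgrowthZ..].
rewrite !gEZ// V V1 V2.
by move: (var F) (var F1) (var F2) => v v1 v2 H; clearbody m; lra.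
Qed.

(** Both inner points y + r and y' - r are convex combinations of the outer points
y - r and y' + r, with complementary weights. *)
Lemma cvx_increment f y y' r : cvx f -> y <= y' -> 0 <= r ->
  f (y + r) - f (y - r) <= f (y' + r) - f (y' - r).
Proof.
move=> fc yy' r0.
have [d0|d0] := eqVneq (y' - y + 2 * r) 0.
  have -> : y' = y by lra.
  by [].
have dpos : 0 < y' - y + 2 * r by rewrite lt_def d0/=; lra.
pose t := (y' - y) / (y' - y + 2 * r).
have t01 : 0 <= t <= 1.
  rewrite /t divr_ge0 ?subr_ge0// ?(ltW dpos)//= ler_pdivrMr// mul1r; lra.
have t01' : 0 <= 1 - t <= 1 by lra.
have := fc t (y - r) (y' + r) t01.
have -> : t * (y - r) + (1 - t) * (y' + r) = y + r by rewrite /t; field.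
have := fc (1 - t) (y - r) (y' + r) t01'.
have -> : (1 - t) * (y - r) + (1 - (1 - t)) * (y' + r) = y' - r by rewrite /t; field.
move: t {t01 t01'} (f (y - r)) (f (y + r)) (f (y' - r)) (f (y' + r)) => ? ? ? ? ? H1 H2.
lra.
Qed.

Definition sqincr f r y : R := (f (y + r) - f (y - r)) ^+ 2.

Lemma sqincrN f r y : sqincr f (- r) y = sqincr f r y.
Proof. by rewrite /sqincr opprK -sqrrN opprB. Qed.

(** The symmetric increment is nondecreasing by convexity.  It is nonnegative in the
monotone case; in the even case it is an odd function, so its square is monotone
in the absolute value. *)
Lemma monob_sqincr b f r : cvx f -> monob b f 0 -> monob b (sqincr f r) 0.
Proof.
move=> fc fm; wlog r0 : r / 0 <= r.
  move=> H; have [|r0] := lerP 0 r; first exact: H.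
  have := H (- r); rewrite oppr_ge0 => /(_ (ltW r0)) H' y y' yy'.
  by have := H' y y' yy'; rewrite !sqincrN.
move=> y y' yy'; rewrite addr0.
case: b fm yy' => fm; rewrite /ord => yy'.
  have fe := monob_even fm.
  have sqE u : sqincr f r u = sqincr f r `|u|.
    have [u0|u0] := lerP 0 u; first by rewrite ger0_norm.
    rewrite ltr0_norm// /sqincr -[in RHS]sqrrN opprB.
    by rewrite -(fe (- u - r)) -(fe (- u + r)) !opprD !opprK.
  rewrite (sqE y) (sqE y') /sqincr ler_sqr ?nnegrE.
  - exact: cvx_increment.
  - have := cvx_increment fc (normr_ge0 y) r0; rewrite add0r sub0r fe subrr//.
  - have := cvx_increment fc (normr_ge0 y') r0; rewrite add0r sub0r fe subrr//.
rewrite /sqincr ler_sqr ?nnegrE ?subr_ge0; first exact: cvx_increment.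
- by have := fm (y - r) (y + r); rewrite addr0; apply; rewrite /ord; lra.
- by have := fm (y' - r) (y' + r); rewrite addr0; apply; rewrite /ord; lra.
Qed.

Lemma lip_sqincr L f r : lip L f -> lip ((2 * L) * (4 * L * `|r|)) (sqincr f r).
Proof.
move=> fL x y; have L0 := lip_ge0 fL; rewrite /sqincr subr_sqr normrM.
have bound u : `|f (u + r) - f (u - r)| <= 2 * L * `|r|.
  apply: le_trans (fL _ _) _.
  rewrite (_ : u + r - (u - r) = 2 * r); last by ring.
  by rewrite normrM (ger0_norm (ler0n _ _)); lra.
rewrite (mulrAC (2 * L)).
apply: ler_pM => //.
  rewrite (_ : _ - _ = (f (x + r) - f (y + r)) - (f (x - r) - f (y - r))); last by ring.
  apply: le_trans (ler_normB _ _) _.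
  have := fL (x + r) (y + r); have := fL (x - r) (y - r).
  have -> : x - r - (y - r) = x - y by ring.
  have -> : x + r - (y + r) = x - y by ring.
  lra.
apply: le_trans (ler_normD _ _) _.
have := bound x; have := bound y; lra.
Qed.

(** With samples u and v replaced by (w + r) / sqrt 2 and (w - r) / sqrt 2, the
increment of f between the two sample points becomes a symmetric increment of
width proportional to r around a point Gaussian in w.  For fixed r the mean over w
is a step with parameter 0 applied to a monotone function. *)
Lemma monob_var L b f h : 0 < h -> lip L f -> cvx f -> monob b f 0 ->
  monob b (fun x => var (fun z => f (x + sqrt h * z))) 0.
Proof.
move=> h0 fL fc fm x x' xx'; rewrite addr0.
have L0 := lip_ge0 fL.
(* The rotation by 45 degrees has cosine [c] and sine [- c]. *)
pose c := sqrt (2^-1 : R).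
have c2 : c ^+ 2 = 2^-1 by rewrite sqr_sqrtr// invr_ge0.
pose k := sqrt (h / 2).
have kE : k = sqrt h * c by rewrite /k sqrtrM// ltW.
have h20 : 0 < h / 2 by rewrite divr_gt0.
pose G y r := gE (fun w => sqincr f (k * r) (y + k * w)).
have varE y : 2 * var (fun z => f (y + sqrt h * z)) = gE (G y).
  have ef := expgrowth_sample h y fL.
  pose F (p : R * R) := (f (y + sqrt h * p.1) - f (y + sqrt h * p.2)) ^+ 2.
  have rotE u v : F (c * u + - - c * v, - c * u + c * v) = sqincr f (k * u) (y + k * v).
    by rewrite /F/= /sqincr kE; congr ((f _ - f _) ^+ 2); ring.
  have mf : measurable_fun setT f := lip_measurable fL.
  have mF : measurable_fun setT F.
    apply: measurable_funX; apply: measurable_funB.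
      apply: measurableT_comp => //; apply: measurable_funD => //.
      by apply: measurable_funM => //.
    apply: measurableT_comp => //; apply: measurable_funD => //.
    by apply: measurable_funM => //.
  transitivity (gE (fun u => gE (fun v => F (u, v)))).
    by rewrite -(gE2_sqr_dist ef).2.
  have cc : c ^+ 2 + (- c) ^+ 2 = 1 by rewrite sqrrN c2; lra.
  have cN0 : - c != 0 by rewrite oppr_eq0 gt_eqF// sqrtr_gt0 invr_gt0.
  rewrite -[LHS](gE2_rotation cc cN0 mF).
  - by apply: eq_gE => u; rewrite /G; apply: eq_gE => v; rewrite rotE.
  - by move=> p; exact: sqr_ge0.
  - by move=> u; rewrite /F/=; exact: (gE_sqr_dist _ ef).1.
  - move=> u; under eq_fun do rewrite rotE.
    exact: (expgrowth_sample (h / 2) y (lip_sqincr (k * u) fL)).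
have GE y r : G y r = gauss_step 0 (h / 2) (sqincr f (k * r)) y.
  by rewrite gauss_step0E.
have mf : measurable_fun setT f := lip_measurable fL.
have eG y : expgrowth (G y).
  have eb : expgrowth (fun r => (2 * L * k * r) ^+ 2).
    exact/expgrowthX/expgrowthZ/expgrowth_id.
  apply: (expgrowth_le _ eb).
    apply: (@measurable_gE2 _ (fun p => sqincr f (k * p.1) (y + k * p.2))); last first.
      by move=> p; exact: sqr_ge0.
    have mlin a : measurable_fun setT (fun p : R * R => f (y + (a * p.1 + k * p.2))).
      apply: measurableT_comp => //; apply: measurable_funD => //.
      exact: measurable_fun_linear2.
    rewrite /sqincr; apply: measurable_funX; apply: measurable_funB.
      by have := mlin k; under eq_fun do rewrite addrCA addrC.
    by have := mlin (- k); under eq_fun do rewrite mulNr addrCA addrC.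
  move=> r; rewrite ger0_norm ?gE_ge0//; last by move=> z; exact: sqr_ge0.
  rewrite ger0_norm ?sqr_ge0// -[leRHS]gE_cst; apply: le_gE.
  - exact: (expgrowth_sample (h / 2) y (lip_sqincr (k * r) fL)).
  - exact: expgrowth_cst.
  move=> z; rewrite /sqincr -(real_normK (num_real (f _ - _))).
  rewrite -[leRHS]real_normK ?num_real// ler_sqr ?nnegrE//.
  apply: le_trans (fL _ _) _.
  rewrite (_ : y + k * z + k * r - (y + k * z - k * r) = 2 * (k * r)); last by ring.
  rewrite (_ : 2 * L * k * r = L * (2 * (k * r))); last by ring.
  by rewrite (normrM L) (ger0_norm L0).
suff : gE (G x) <= gE (G x') by rewrite -!varE; lra.
apply: le_gE => // r; rewrite !GE.
have sqL := lip_sqincr (k * r) fL; have sqm := monob_sqincr (k * r) fc fm.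
have cL : lip ((2 * L) * (4 * L * `|k * r|)) (fun=> 0 : R).
  by move=> u v; rewrite subrr normr0 !mulr_ge0.
have cm : monob b (fun=> 0 : R) 0 by move=> u v _; rewrite addr0.
have dm : monob b (fun x => sqincr f (k * r) x - 0) 0.
  by move=> u v uv; rewrite !subr0; exact: sqm.
have := monob_gauss_step h20 (lexx 0) (lexx 0) cL sqL cm sqm dm xx'.
by rewrite !(gauss_step0E _ (fun=> 0)) gE_cst !subr0 addr0.
Qed.

Lemma normr_expR_sub2 (y : R) : `|expR y - 1 - y| <= y ^+ 2 * expR `|y|.
Proof.
have up : expR y - 1 <= y * expR y.
  have := ler_wpM2r (expR_ge0 y) (expR_ge1Dx (- y)).
  by rewrite -expRD addNr expR0; lra.
have lo := expR_ge1Dx y.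
rewrite ger0_norm; last by lra.
apply: (@le_trans _ _ (y * (expR y - 1))); first by lra.
rewrite expr2 -mulrA.
have [y0|y0] := lerP 0 y; first by rewrite ger0_norm// ler_wpM2l.
have e1 : 1 <= expR `|y| by rewrite -[leLHS](expR0 R) ler_expR.
rewrite ler_nM2l//; apply: (@le_trans _ _ y); last by lra.
by rewrite -[leRHS]mulr1 ler_nM2l.
Qed.

(** Mean value theorem, the derivative being bounded by [normr_expR_sub2]. *)
Lemma normr_expR_sub3 (y : R) :
  `|expR y - 1 - y - y ^+ 2 / 2| <= `|y| ^+ 3 * expR `|y|.
Proof.
pose g (u : R) := expR u - 1 - u - u ^+ 2 / 2.
pose dg (u : R) := expR u - 1 - u.
have gd (u : R) : is_derive u 1 g (dg u).
  rewrite /g /dg; apply: is_derive_eq.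
  have scaleE (p q : R) : p *: (q : R^o) = p * q by [].
  by rewrite !scaleE; lra.
have cg (a b : R) : {within `[a, b], continuous g}.
  apply: continuous_subspaceT => u.
  by apply: differentiable_continuous; apply/derivable1_diffP; exact: ex_derive.
have g0 : g 0 = 0 by rewrite /g expR0; ring.
have main xi : `|xi| <= `|y| -> `|dg xi * y| <= `|y| ^+ 3 * expR `|y|.
  move=> xy; rewrite normrM mulrC exprS -mulrA ler_wpM2l//.
  apply: le_trans (normr_expR_sub2 xi) _.
  rewrite -[X in X ^+ 2 * _ <= _]/xi -(real_normK (num_real xi)).
  apply: ler_pM; rewrite ?sqr_ge0 ?expR_ge0 ?ler_expR//.
  by rewrite ler_sqr ?nnegrE.
rewrite -/(g y); have [y0|y0|y0] := ltgtP y 0.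
- have [xi] := MVT_segment (ltW y0) (fun u _ => gd u) (cg y 0).
  rewrite in_itv/= => /andP[yx x0]; rewrite g0 !sub0r => E.
  have -> : g y = dg xi * y by lra.
  by apply: main; rewrite (ler0_norm x0) (ltr0_norm y0); lra.
- have [xi] := MVT_segment (ltW y0) (fun u _ => gd u) (cg 0 y).
  rewrite in_itv/= => /andP[x0 xy]; rewrite g0 !subr0 => ->.
  by apply: main; rewrite (ger0_norm x0) (gtr0_norm y0).
- by rewrite y0 g0 normr0 mulr_ge0 ?expR_ge0.
Qed.

Lemma ln1D_sub (u : R) : 0 <= u -> u - u ^+ 2 <= ln (1 + u) <= u.
Proof.
move=> u0; have pos : 0 < 1 + u by lra.
apply/andP; split; last by apply: le_ln1Dx; lra.
have : ln (1 + u)^-1 <= (1 + u)^-1 - 1.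
  have := @le_ln1Dx R ((1 + u)^-1 - 1).
  by rewrite subrKC ltrBrDl subrr invr_gt0; apply.
rewrite lnV// => H.
have : u - u ^+ 2 <= 1 - (1 + u)^-1.
  rewrite -subr_ge0 (_ : _ - _ = u ^+ 3 / (1 + u)); last by field; rewrite gt_eqF.
  by rewrite divr_ge0 ?exprn_ge0// ltW.
lra.
Qed.

End Variance.

(** * Expansion of the operator on a short step *)

Section SmallStep.
Context {R : realType}.
Local Notation sqrt := Num.sqrt.
Implicit Types (f g F : R -> R) (m h x y t c e L : R) (b : bool).

(** [sqrt h * fluct L z] bounds the deviation of an [L]-Lipschitz function from its
mean at the sample [z].  The summand 1 makes it at least 1, so that
[fluct_moment] also bounds the mean of its square ([fluct_sqr_le]). *)
Definition fluct L (z : R) : R := L * (`|z| + gE (fun v : R => `|v|)) + 1.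

Definition fluct_moment L : R := gE (fun z => fluct L z ^+ 3 * expR (fluct L z)).

Definition step_err L : R := fluct_moment L + 4 * fluct_moment L ^+ 2.

Lemma gE_abs_ge0 : 0 <= gE (fun v : R => `|v|).
Proof. exact: gE_ge0. Qed.

Lemma fluct_ge1 L z : 0 <= L -> 1 <= fluct L z.
Proof. by move=> L0; rewrite lerDr mulr_ge0// addr_ge0// gE_abs_ge0. Qed.

Lemma expgrowth_fluct L : 0 <= L ->
  expgrowth (fun z => fluct L z ^+ 3 * expR (fluct L z)).
Proof.
move=> L0.
have fL : lip L (fluct L).
  move=> x y; rewrite /fluct opprD addrACA subrr addr0 -mulrBr normrM ger0_norm//.
  by rewrite ler_wpM2l// opprD addrACA subrr addr0; exact: ler_dist_dist.
apply: expgrowthM; first exact/expgrowthX/(lip_expgrowth fL).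
by have := lip_expgrowth_expR 1 fL; under eq_fun do rewrite mul1r.
Qed.

Lemma fluct_sqr_le L z : 0 <= L -> fluct L z ^+ 2 <= fluct L z ^+ 3 * expR (fluct L z).
Proof.
move=> L0; have W1 := fluct_ge1 z L0.
have e1 : 1 <= expR (fluct L z).
  by rewrite -[leLHS](expR0 R) ler_expR (le_trans ler01).
rewrite (exprS _ 2) mulrAC -[leLHS]mul1r ler_wpM2r ?sqr_ge0//.
by rewrite -[leLHS]mulr1; apply: ler_pM.
Qed.

Lemma fluct_moment_ge0 L : 0 <= L -> 0 <= fluct_moment L.
Proof.
move=> L0; apply: gE_ge0 => z; rewrite mulr_ge0 ?expR_ge0// exprn_ge0//.
by apply: le_trans (fluct_ge1 z L0).
Qed.

Lemma step_err_ge0 L : 0 <= L -> 0 <= step_err L.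
Proof.
by move=> L0; rewrite addr_ge0 ?fluct_moment_ge0// mulr_ge0// sqr_ge0.
Qed.

Lemma sample_fluct L h f x z : lip L f ->
  `|f (x + sqrt h * z) - gE (fun v => f (x + sqrt h * v))| <= sqrt h * fluct L z.
Proof.
move=> fL; have L0 := lip_ge0 fL; have ef := expgrowth_sample h x fL.
have e1 : expgrowth (fun=> f (x + sqrt h * z)) by exact: expgrowth_cst.
rewrite -[f (x + sqrt h * z)](gE_cst (f (x + sqrt h * z))) -gEB//.
apply: le_trans (normr_gE (expgrowthB e1 ef)) _.
have ea : expgrowth (fun v : R => `|v|) by exact/expgrowth_abs/expgrowth_id.
have eR : expgrowth (fun v : R => sqrt h * L * `|z| + sqrt h * L * `|v|).
  by apply: expgrowthD; [exact: expgrowth_cst|exact: expgrowthZ].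
apply: (@le_trans _ _ (gE (fun v : R => sqrt h * L * `|z| + sqrt h * L * `|v|))).
  apply: le_gE => //; first exact/expgrowth_abs/expgrowthB.
  move=> v; apply: le_trans (fL _ _) _.
  rewrite opprD addrACA subrr add0r -mulrBr normrM ger0_norm ?sqrtr_ge0//.
  rewrite -mulrDr mulrA [L * _]mulrC ler_wpM2l//; last exact: ler_normB.
  by rewrite mulr_ge0// sqrtr_ge0.
rewrite gED; [|exact: expgrowth_cst|exact: expgrowthZ].
rewrite gE_cst gEZ// -mulrDr -mulrA ler_wpM2l ?sqrtr_ge0// /fluct; lra.
Qed.

Lemma var_bounds L h f x : lip L f -> 0 <= h ->
  0 <= var (fun z => f (x + sqrt h * z)) <= h * fluct_moment L.
Proof.
move=> fL h0; have L0 := lip_ge0 fL; have ef := expgrowth_sample h x fL.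
rewrite var_center//; set a := gE (fun v => f (x + sqrt h * v)).
have ec : expgrowth (fun z => (f (x + sqrt h * z) - a) ^+ 2).
  by apply/expgrowthX/expgrowthB => //; exact: expgrowth_cst.
apply/andP; split; first by apply: gE_ge0 => z; exact: sqr_ge0.
rewrite -gEZ; last exact: expgrowth_fluct.
apply: le_gE => //; first exact/expgrowthZ/expgrowth_fluct.
move=> z; apply: (@le_trans _ _ ((sqrt h * fluct L z) ^+ 2)).
  rewrite -(real_normK (num_real (_ - a))) ler_sqr ?nnegrE//.
    exact: sample_fluct.
  by rewrite mulr_ge0 ?sqrtr_ge0// (le_trans _ (fluct_ge1 z L0)).
by rewrite exprMn sqr_sqrtr// ler_wpM2l// fluct_sqr_le.
Qed.

(** With [Y] the centred sample times [m], E e^Y = 1 + E Y^2 / 2 up to the third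
moment of [Y], which is of order (m sqrt h)^3; the logarithm then costs the square
of E Y^2.  Dividing by [m] leaves an error of order m^2 h^(3/2). *)
Lemma gauss_step_expansion L m h f x : lip L f -> 0 <= m <= 1 -> 0 <= h <= 1 ->
  `|gauss_step m h f x - gE (fun z => f (x + sqrt h * z)) -
    m / 2 * var (fun z => f (x + sqrt h * z))| <= step_err L * (h * sqrt h).
Proof.
move=> fL /andP[m_ge0 m1] /andP[h0 h1].
have L0 := lip_ge0 fL; have ef := expgrowth_sample h x fL.
have r0 := sqrtr_ge0 h.
have err0 : 0 <= step_err L * (h * sqrt h) by rewrite !mulr_ge0// step_err_ge0.
move: m_ge0; rewrite le_eqVlt => /predU1P[<-|m0].
  by rewrite gauss_step0E mul0r mul0r subr0 subrr normr0.
have mN0 : m != 0 by rewrite gt_eqF.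
set F := fun z => f (x + sqrt h * z).
set a := gE F; set v := m ^+ 2 / 2 * var F.
pose Y z := m * (F z - a).
have eFa : expgrowth (fun z => F z - a) by apply: expgrowthB => //; exact: expgrowth_cst.
have eY : expgrowth Y by exact: expgrowthZ.
have gEY : gE Y = 0 by rewrite /Y gEZ// gEB// ?gE_cst ?subrr ?mulr0//; exact: expgrowth_cst.
have gEY2 : gE (fun z => Y z ^+ 2 / 2) = v.
  rewrite /v var_center// -gEZ; last exact: expgrowthX.
  by apply: eq_gE => z; rewrite /Y -/a exprMn mulrAC.
have eeF := expgrowth_expR_sample m h x fL.
have YE z : expR (Y z) = expR (- (m * a)) * expR (m * F z).
  by rewrite -expRD /Y mulrBr addrC.
have eeY : expgrowth (fun z => expR (Y z)).
  by under eq_fun do rewrite YE; exact: expgrowthZ.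
set N := gE (fun z => expR (Y z)).
have TN : m * (gauss_step m h f x - a) = ln N.
  have -> : N = expR (m * (gauss_step m h f x - a)).
    rewrite /N; under eq_gE do rewrite YE.
    by rewrite gEZ// -(expR_gauss_step _ _ fL)// -expRD mulrBr addrC.
  by rewrite expRK.
have N1 : 1 <= N by have := expR_gE eY eeY; rewrite gEY expR0.
set W := fluct L; set K := fluct_moment L; set s := m * sqrt h.
have K0 : 0 <= K by exact: fluct_moment_ge0.
have s0 : 0 <= s by rewrite mulr_ge0// ltW.
have r1 : sqrt h <= 1 by rewrite -sqrtr1 ler_wsqrtr.
have s1 : s <= 1 by rewrite -[leRHS]mulr1 ler_pM// ltW.
have YW z : `|Y z| <= s * W z.
  rewrite /Y normrM gtr0_norm// /s -mulrA ler_wpM2l ?(ltW m0)//.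
  exact: sample_fluct.
have W0 z : 0 <= W z by apply: le_trans (fluct_ge1 z L0).
have NK : `|N - 1 - v| <= s ^+ 3 * K.
  have eY2 : expgrowth (fun z => Y z ^+ 2 / 2).
    under eq_fun do rewrite mulrC; exact/expgrowthZ/expgrowthX.
  have e1 : expgrowth (fun=> 1 : R) by exact: expgrowth_cst.
  have -> : N - 1 - v = gE (fun z => expR (Y z) - 1 - Y z - Y z ^+ 2 / 2).
    rewrite gEB//; last by apply: expgrowthB => //; exact: expgrowthB.
    rewrite gEB//; last exact: expgrowthB.
    by rewrite gEB// gE_cst gEY subr0 gEY2.
  have e3 : expgrowth (fun z => expR (Y z) - 1 - Y z - Y z ^+ 2 / 2).
    by apply: expgrowthB => //; apply: expgrowthB => //; exact: expgrowthB.
  apply: le_trans (normr_gE e3) _.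
  rewrite /K -gEZ; last exact: expgrowth_fluct.
  apply: le_gE; [exact: expgrowth_abs|exact/expgrowthZ/expgrowth_fluct|].
  move=> z; apply: le_trans (normr_expR_sub3 _) _.
  rewrite mulrA -exprMn; apply: ler_pM; rewrite ?exprn_ge0 ?expR_ge0//.
    by rewrite lerXn2r ?nnegrE// mulr_ge0.
  rewrite ler_expR; apply: le_trans (YW z) _.
  by rewrite -[leRHS]mul1r ler_wpM2r.
have h2 : sqrt h ^+ 2 = h by rewrite sqr_sqrtr.
have [var0 varK] := andP (var_bounds x fL h0).
have v0 : 0 <= v by rewrite mulr_ge0// divr_ge0// sqr_ge0.
have vK : v <= s ^+ 2 * K.
  apply: (@le_trans _ _ (m ^+ 2 / 2 * (h * K))).
    by rewrite ler_wpM2l// divr_ge0// sqr_ge0.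
  rewrite /s exprMn h2.
  have : 0 <= m ^+ 2 * h * K by rewrite !mulr_ge0// ltW.
  lra.
(* u <= s^3 K + v and v <= s^2 K, where s <= 1; one of the two factors s^2 of the
   square of this bound is then weakened to s. *)
set u := N - 1.
have u0 : 0 <= u by rewrite subr_ge0.
have lnN : u - u ^+ 2 <= ln N <= u.
  by have := ln1D_sub u0; rewrite (_ : 1 + u = N)// /u; ring.
have s2 : 0 <= s ^+ 2 * K by rewrite mulr_ge0// sqr_ge0.
have s3s2 : s ^+ 3 * K <= s ^+ 2 * K.
  by rewrite ler_wpM2r// exprS -[leRHS]mul1r ler_wpM2r// sqr_ge0.
have uK : u <= 2 * (s ^+ 2 * K).
  by have := ler_norm (N - 1 - v); rewrite -/u in NK *; lra.
have u2 : u ^+ 2 <= 4 * (s ^+ 3 * K ^+ 2).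
  apply: (@le_trans _ _ ((2 * (s ^+ 2 * K)) ^+ 2)).
    by rewrite ler_sqr ?nnegrE// mulr_ge0.
  rewrite (_ : _ ^+ 2 = s * (4 * (s ^+ 3 * K ^+ 2))); last by ring.
  rewrite -[leRHS]mul1r ler_wpM2r// mulr_ge0// mulr_ge0// ?sqr_ge0//.
  exact: exprn_ge0.
have main : `|ln N - v| <= s ^+ 3 * step_err L.
  rewrite /step_err -/K mulrDr.
  rewrite (_ : s ^+ 3 * (4 * K ^+ 2) = 4 * (s ^+ 3 * K ^+ 2)); last by ring.
  move: NK lnN; rewrite -/u !ler_norml => /andP[NK1 NK2] /andP[l1 l2].
  by apply/andP; split; lra.
rewrite -(ler_pM2l m0) -[X in X * `|_|]gtr0_norm// -normrM.
have -> : m * (gauss_step m h f x - a - m / 2 * var F) = ln N - v.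
  by rewrite mulrBr TN /v; congr (_ - _); field.
apply: le_trans main _.
rewrite /s (_ : (m * sqrt h) ^+ 3 = m * (m * m * (h * sqrt h))); last first.
  by rewrite -[X in m * (m * m * (X * _))]h2; ring.
rewrite -mulrA ler_wpM2l ?(ltW m0)// [leRHS]mulrC ler_wpM2r ?step_err_ge0//.
rewrite -[leRHS]mul1r ler_wpM2r ?mulr_ge0// -[leRHS]mulr1.
by apply: ler_pM; rewrite ?(ltW m0).
Qed.

End SmallStep.

(** * From short steps to long ones: comparing different parameters *)

Section ManySteps.
Context {R : realType}.
Local Notation sqrt := Num.sqrt.
Implicit Types (f g F : R -> R) (m h d x y t c e L : R) (b : bool) (k n : nat).

#[local] Opaque var gE.

Lemma norm_le_bounds (u e : R) : `|u| <= e -> - e <= u /\ u <= e.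
Proof. by rewrite ler_norml => /andP. Qed.

Lemma lip_iter L m d f k : lip L f -> 0 <= m -> lip L (iter k (gauss_step m d) f).
Proof. by move=> fL m0; elim: k => //= k IH; exact: lip_gauss_step. Qed.

Lemma iter_gauss_step L m d f k : lip L f -> 0 <= m -> 0 < d ->
  iter k.+1 (gauss_step m d) f = gauss_step m (d *+ k.+1) f.
Proof.
move=> fL m0 d0; elim: k => [|k IH]; first by [].
have dk : 0 < d *+ k.+1 by rewrite pmulrn_lgt0.
rewrite iterS IH; apply/funext => x.
by rewrite (gauss_step_semigroup _ fL m0 d0 dk) [in RHS]mulrS.
Qed.

Lemma gauss_step_subdivide L m h f n : lip L f -> 0 <= m -> 0 < h ->
  gauss_step m h f = iter n.+1 (gauss_step m (h / n.+1%:R)) f.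
Proof.
move=> fL m0 h0.
have d0 : 0 < h / n.+1%:R by rewrite divr_gt0.
by rewrite (iter_gauss_step _ fL m0 d0) -[_ *+ _]mulr_natr divfK.
Qed.

(** The total error of n + 1 short steps is of order 1 / sqrt (n + 1). *)
Lemma le_subdivision (a c' c h : R) : 0 <= c -> 0 <= h ->
  (forall n, a <= c' + n.+1%:R * (c * (h / n.+1%:R * sqrt (h / n.+1%:R)))) ->
  a <= c'.
Proof.
move=> c0 h0 H; rewrite leNgt; apply/negP => ca.
(* If D = a - c' > 0, the bound reads D <= C sqrt (h / (n + 1)), which fails as soon
   as n + 1 > C^2 h / D^2. *)
pose C := c * h; have C0 : 0 <= C by exact: mulr_ge0.
pose D := a - c'; have D0 : 0 < D by rewrite subr_gt0.
have q0 : 0 <= C ^+ 2 * h / D ^+ 2 by rewrite divr_ge0 ?sqr_ge0// mulr_ge0// sqr_ge0.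
have := archi_boundP q0; set n := Num.bound _ => qn.
have n0 : 0 < n.+1%:R :> R by [].
have : D <= C * sqrt (h / n.+1%:R).
  have := H n; rewrite (_ : n.+1%:R * _ = C * sqrt (h / n.+1%:R)); first by rewrite /D; lra.
  by rewrite /C; field; rewrite addrC -natr1 gt_eqF.
rewrite -ler_sqr ?nnegrE ?(ltW D0)//; last by rewrite mulr_ge0// sqrtr_ge0.
rewrite exprMn sqr_sqrtr ?divr_ge0// mulrA ler_pdivlMr//.
apply/negP; rewrite -ltNge.
move: qn; rewrite ltr_pdivrMr ?exprn_gt0// => /lt_le_trans; apply.
by rewrite [leRHS]mulrC ler_wpM2r ?sqr_ge0// ler_nat.
Qed.

Lemma small_step_dist L m m' d f x : lip L f -> 0 <= m <= 1 -> 0 <= m' <= 1 ->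
  0 <= d <= 1 ->
  `|gauss_step m d f x - gauss_step m' d f x| <=
  fluct_moment L * `|m - m'| * d + 2 * step_err L * (d * sqrt d).
Proof.
move=> fL m01 m'01 d01.
have := gauss_step_expansion x fL m01 d01; have := gauss_step_expansion x fL m'01 d01.
have [d0 d1] := andP d01.
have [v0 vK] := andP (var_bounds x fL d0).
set a := gE _; set v := var _ in v0 vK *.
set T := gauss_step m d f x; set T' := gauss_step m' d f x.
set E := step_err L * _ => H' H.
rewrite (_ : T - T' =
  (T - a - m / 2 * v) - (T' - a - m' / 2 * v) + (m - m') / 2 * v); last first.
  by field.
apply: le_trans (ler_normD _ _) _; rewrite addrC; apply: lerD; last first.
  apply: le_trans (ler_normB _ _) _; rewrite -[leRHS]mulrA -/E; lra.
rewrite !normrM (ger0_norm v0) (@ger0_norm _ (2^-1))//.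
have : `|m - m'| * v <= `|m - m'| * (d * fluct_moment L) by rewrite ler_wpM2l.
have : 0 <= `|m - m'| * v by rewrite mulr_ge0.
lra.
Qed.

(** The means agree and the variance is of order [h], so on a short step only the
term (m - m') / 2 times the variance and the expansion errors remain. *)
Lemma gauss_step_lip_param L m m' h f x : lip L f -> 0 <= m <= 1 -> 0 <= m' <= 1 ->
  0 < h <= 1 ->
  `|gauss_step m h f x - gauss_step m' h f x| <= fluct_moment L * `|m - m'| * h.
Proof.
move=> fL m01 m'01 /andP[h0 h1]; have L0 := lip_ge0 fL.
have [m0 m1] := andP m01; have [m'0 m'1] := andP m'01.
apply: (@le_subdivision _ _ (2 * step_err L) h); rewrite ?(ltW h0)//.
  by rewrite mulr_ge0// step_err_ge0.
move=> n; rewrite (gauss_step_subdivide n fL m0 h0) (gauss_step_subdivide n fL m'0 h0).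
set d := h / n.+1%:R.
have d01 : 0 <= d <= 1.
  rewrite divr_ge0 ?(ltW h0)//= ler_pdivrMr// mul1r (le_trans h1)// ler1n//.
have hE : h = n.+1%:R * d by rewrite mulrC divfK.
rewrite [in leRHS]hE.
suff H k : `|iter k (gauss_step m d) f x - iter k (gauss_step m' d) f x| <=
    k%:R * (fluct_moment L * `|m - m'| * d + 2 * step_err L * (d * sqrt d)).
  apply: le_trans (H n.+1) _; rewrite le_eqVlt; apply/orP; left; apply/eqP; ring.
elim: k x => [|k IH] x; first by rewrite /= subrr normr0 mul0r.
rewrite !iterS; set F := iter k _ _; set F' := iter k _ _.
have FL : lip L F by exact: lip_iter.
have F'L : lip L F' by exact: lip_iter.
have D1 := small_step_dist x FL m01 m'01 d01.
have D2 := dist_gauss_step d FL F'L m'0 IH x.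
rewrite -natr1 mulrDl mul1r.
apply: le_trans (ler_distD (gauss_step m' d F x) _ _) _.
by rewrite addrC lerD.
Qed.

Lemma gauss_step_cst0 m h x : gauss_step m h (fun=> 0) x = 0 :> R.
Proof.
have [->|m0] := eqVneq m 0; first by rewrite gauss_step0E gE_cst.
by rewrite gauss_stepE// mulr0 expR0 gE_cst ln1 mulr0.
Qed.

Lemma monob_gauss_step1 L b m h f : 0 < h -> 0 <= m -> lip L f -> monob b f 0 ->
  monob b (gauss_step m h f) 0.
Proof.
move=> h0 m0 fL fm.
have cL : lip L (fun=> 0 : R) by move=> u v; rewrite subrr normr0 mulr_ge0// (lip_ge0 fL).
have cm : monob b (fun=> 0 : R) 0 by move=> u v _; rewrite addr0.
have dm : monob b (fun x => f x - 0) 0 by move=> u v uv; rewrite !subr0; exact: fm.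
have H := monob_gauss_step h0 m0 (lexx 0) cL fL cm fm dm.
by move=> u v uv; have := H u v uv; rewrite !gauss_step_cst0 !subr0.
Qed.

(** On a short step the difference grows by (m2 - m1) / 2 times a monotone variance,
and the part already accumulated stays monotone by [monob_gauss_step]; each step
adds to the slack the four expansion errors (two parameters at two points). *)
Lemma monob_gauss_step_param L b m1 m2 h f : 0 < h <= 1 -> 0 <= m1 -> m1 <= m2 ->
  m2 <= 1 -> lip L f -> cvx f -> monob b f 0 ->
  monob b (fun x => gauss_step m2 h f x - gauss_step m1 h f x) 0.
Proof.
move=> /andP[h0 h1] m10 m12 m21 fL fc fm x y xy; rewrite addr0.
have L0 := lip_ge0 fL.
have m20 : 0 <= m2 by exact: le_trans m12.
have m101 : 0 <= m1 <= 1 by rewrite m10 (le_trans m12).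
have m201 : 0 <= m2 <= 1 by rewrite m20.
apply: (@le_subdivision _ _ (4 * step_err L) h); rewrite ?(ltW h0)//.
  by rewrite mulr_ge0// step_err_ge0.
move=> n; rewrite (gauss_step_subdivide n fL m10 h0) (gauss_step_subdivide n fL m20 h0).
set d := h / n.+1%:R.
have d0 : 0 < d by rewrite divr_gt0.
have d01 : 0 <= d <= 1.
  by rewrite (ltW d0)/= ler_pdivrMr// mul1r (le_trans h1)// ler1n.
set E := 4 * _ * _.
have E0 : 0 <= E by rewrite !mulr_ge0// ?sqrtr_ge0 ?step_err_ge0// ltW.
(* Both steps are expanded at the iterates with parameter m2, whose convexity makes
   the variance monotone. *)
suff H k : cvx (iter k (gauss_step m2 d) f) /\
    [/\ monob b (iter k (gauss_step m1 d) f) 0,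
    monob b (iter k (gauss_step m2 d) f) 0 &
    monob b (fun x => iter k (gauss_step m2 d) f x - iter k (gauss_step m1 d) f x)
      (k%:R * E)].
  by have [_ [_ _]] := H n.+1; apply.
elim: k {x y xy} => [|k [Fc [F1m F2m F21]]].
  by split=> //; split=> //= x y _; rewrite !subrr mul0r addr0.
rewrite !iterS; set F1 := iter k (gauss_step m1 d) f in F1m F21 *.
set F2 := iter k (gauss_step m2 d) f in Fc F2m F21 *.
have F1L : lip L F1 by exact: lip_iter.
have F2L : lip L F2 by exact: lip_iter.
split; first exact: cvx_gauss_step.
split; [exact: monob_gauss_step1 F1L F1m|exact: monob_gauss_step1 F2L F2m|].
move=> x y xy.
have kE0 : 0 <= k%:R * E by exact: mulr_ge0.
have A := monob_gauss_step d0 m10 kE0 F1L F2L F1m F2m F21 xy.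
have V := monob_var d0 F2L Fc F2m xy; rewrite addr0 in V.
have [] := norm_le_bounds (gauss_step_expansion x F2L m101 d01).
have [] := norm_le_bounds (gauss_step_expansion x F2L m201 d01).
have [] := norm_le_bounds (gauss_step_expansion y F2L m101 d01).
have [] := norm_le_bounds (gauss_step_expansion y F2L m201 d01).
have -> : step_err L * (d * sqrt d) = E / 4 by rewrite /E; field.
have -> : k.+1%:R * E = k%:R * E + E by rewrite -[k.+1%:R]natr1 mulrDl mul1r.
have mm : 0 <= (m2 - m1) / 2 by rewrite divr_ge0 ?subr_ge0.
have mV := ler_wpM2l mm V.
move: (k%:R * E) mV A.
move: (var _) (var _) (gE _) (gE _) => vx vy ax ay kE.
move: (gauss_step m1 d F1 x) (gauss_step m1 d F1 y) => p1 p2.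
move: (gauss_step m1 d F2 x) (gauss_step m1 d F2 y) => q1 q2.
move: (gauss_step m2 d F2 x) (gauss_step m2 d F2 y) => r1 r2.
clearbody E; clear; lra.
Qed.

(** The finite-difference form of |f1'| <= |f2'| that a step with parameters m1 <= m2
propagates. *)
Definition dominated b L f1 f2 : Prop :=
  [/\ lip L f1 /\ lip L f2, monob b f1 0 /\ monob b f2 0, cvx f2 &
      monob b (fun x => f2 x - f1 x) 0].

Lemma dominated_gauss_step b L f1 f2 m1 m2 h : 0 < h <= 1 -> 0 <= m1 -> m1 <= m2 ->
  m2 <= 1 -> dominated b L f1 f2 ->
  dominated b L (gauss_step m1 h f1) (gauss_step m2 h f2).
Proof.
move=> h01 m10 m12 m21 [[f1L f2L] [f1m f2m] f2c f21].
have [h0 h1] := andP h01.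
have m20 : 0 <= m2 by exact: le_trans m12.
split; first by split; exact: lip_gauss_step.
- by split; [exact: monob_gauss_step1 f1L f1m|exact: monob_gauss_step1 f2L f2m].
- exact: cvx_gauss_step.
- move=> x y xy.
  have := monob_gauss_step h0 m10 (lexx 0) f1L f2L f1m f2m f21 xy.
  have := monob_gauss_step_param h01 m10 m12 m21 f2L f2c f2m xy.
  lra.
Qed.

Lemma dominated_increments b L f1 f2 : dominated b L f1 f2 ->
  forall y y', `|f1 y - f1 y'| <= `|f2 y - f2 y'|.
Proof.
move=> [_ [f1m f2m] _ f21].
suff H y y' : ord b y <= ord b y' -> `|f1 y - f1 y'| <= `|f2 y - f2 y'|.
  move=> y y'; case/orP: (ord_total b y y'); first exact: H.
  by move/H; rewrite (distrC (f1 y')) (distrC (f2 y')).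
move=> yy'; have := f1m _ _ yy'; have := f2m _ _ yy'; have := f21 _ _ yy'.
rewrite !addr0 => d d2 d1.
by rewrite ler0_norm ?subr_le0// ler0_norm ?subr_le0//; lra.
Qed.

(** On a short step the means satisfy an equality and the variances satisfy
[var_convex_comb], so at most two expansion errors are lost per step. *)
Lemma gauss_step_convex_param b L f f1 f2 m1 m2 t h : 0 < h <= 1 ->
  0 <= m1 -> m1 <= m2 -> m2 <= 1 -> 0 <= t <= 1 ->
  dominated b L f1 f2 -> lip L f ->
  (forall y, f y <= t * f1 y + (1 - t) * f2 y) ->
  forall x, gauss_step (t * m1 + (1 - t) * m2) h f x <=
    t * gauss_step m1 h f1 x + (1 - t) * gauss_step m2 h f2 x.
Proof.
move=> /andP[h0 h1] m10 m12 m21 t01 dom fL ff x.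
have [[f1L f2L] _ _ _] := dom; have L0 := lip_ge0 fL.
have m20 : 0 <= m2 by exact: le_trans m12.
have m101 : 0 <= m1 <= 1 by rewrite m10 (le_trans m12).
have m201 : 0 <= m2 <= 1 by rewrite m20.
have [t0 t1] := andP t01.
set m := t * m1 + _.
have m_ge0 : 0 <= m by rewrite addr_ge0// mulr_ge0// subr_ge0.
have m01 : 0 <= m <= 1.
  rewrite m_ge0/= /m; have : t * m1 <= t by rewrite ler_piMr//; lra.
  have : (1 - t) * m2 <= 1 - t by rewrite ler_piMr// subr_ge0.
  lra.
apply: (@le_subdivision _ _ (2 * step_err L) h); rewrite ?(ltW h0)//.
  by rewrite mulr_ge0// step_err_ge0.
move=> n; rewrite (gauss_step_subdivide n fL m_ge0 h0).
rewrite (gauss_step_subdivide n f1L m10 h0) (gauss_step_subdivide n f2L m20 h0).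
set d := h / n.+1%:R.
have d0 : 0 < d by rewrite divr_gt0.
have d1 : d <= 1 by rewrite ler_pdivrMr// mul1r (le_trans h1)// ler1n.
have d01 : 0 <= d <= 1 by rewrite ltW.
have dp01 : 0 < d <= 1 by rewrite d0.
set E := 2 * _ * _.
suff H k : dominated b L (iter k (gauss_step m1 d) f1) (iter k (gauss_step m2 d) f2) /\
    forall x, iter k (gauss_step m d) f x <= t * iter k (gauss_step m1 d) f1 x +
      (1 - t) * iter k (gauss_step m2 d) f2 x + k%:R * E.
  by have [_] := H n.+1; apply.
elim: k => [|k [{}dom IH]]; first by split=> // y; rewrite mul0r addr0.
rewrite !iterS; set F := iter k (gauss_step m d) f in IH *.
set F1 := iter k (gauss_step m1 d) f1 in dom IH *.
set F2 := iter k (gauss_step m2 d) f2 in dom IH *.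
have FL : lip L F by exact: lip_iter.
split; first exact: dominated_gauss_step.
move=> {}x.
have [[F1L F2L] _ _ _] := dom.
pose G y := t * F1 y + (1 - t) * F2 y.
have GL : lip L G.
  move=> u v.
  rewrite /G (_ : _ - _ = t * (F1 u - F1 v) + (1 - t) * (F2 u - F2 v)); last by ring.
  apply: le_trans (ler_normD _ _) _.
  rewrite !normrM (ger0_norm t0) (@ger0_norm _ (1 - t)) ?subr_ge0//.
  have : t * `|F1 u - F1 v| <= t * (L * `|u - v|) by rewrite ler_wpM2l.
  have : (1 - t) * `|F2 u - F2 v| <= (1 - t) * (L * `|u - v|).
    by rewrite ler_wpM2l// subr_ge0.
  lra.
have FG : gauss_step m d F x <= gauss_step m d G x + k%:R * E.
  by apply: (le_gauss_step FL GL) => // z; exact: IH.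
have e1 := expgrowth_sample d x F1L; have e2 := expgrowth_sample d x F2L.
have EG : gE (fun z => G (x + sqrt d * z)) =
    t * gE (fun z => F1 (x + sqrt d * z)) + (1 - t) * gE (fun z => F2 (x + sqrt d * z)).
  by rewrite /G gED ?gEZ//; exact: expgrowthZ.
have VG := var_convex_comb e1 e2 m10 m12 t01 (fun u v => dominated_increments dom _ _).
have [] := norm_le_bounds (gauss_step_expansion x GL m01 d01).
have [] := norm_le_bounds (gauss_step_expansion x F1L m101 d01).
have [] := norm_le_bounds (gauss_step_expansion x F2L m201 d01).
rewrite EG.
have -> : step_err L * (d * sqrt d) = E / 2 by rewrite /E; field.
have -> : k.+1%:R * E = k%:R * E + E by rewrite -[k.+1%:R]natr1 mulrDl mul1r.
move: FG VG; rewrite -/m -[fun z => _ + _]/(fun z => G (x + sqrt d * z)).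
move: (k%:R * E).
move: (var (fun z => G _)) (var (fun z => F1 _)) (var (fun z => F2 _)) => v v1 v2.
move: (gE _) (gE _) => a1 a2 kE.
move: (gauss_step m d F x) (gauss_step m d G x) => p q.
move: (gauss_step m1 d F1 x) (gauss_step m2 d F2 x) => r1 r2.
have t1' : 0 <= 1 - t by rewrite subr_ge0.
move=> pq VG H1 H2 H3 _ _ H4.
have T1 := ler_wpM2l t0 H3.
have T2 := ler_wpM2l t1' H1.
move: pq VG H4 T1 T2; clearbody m E; clear; lra.
Qed.

End ManySteps.

(** * Solutions for step functions and their L^1 limits *)

Section StepSolutions.
Context {R : realType}.
Local Notation mu := (@lebesgue_measure R).
Implicit Types (f g a : R -> R) (m h x t c e L : R) (s : seq (R * R)).

(** [step_sol] at time 1, without the case distinctions on the time. *)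
Fixpoint run_steps f (t0 : R) s : R -> R :=
  match s with
  | [::] => f
  | (t1, m) :: s' => run_steps (gauss_step m (t1 - t0) f) t1 s'
  end.

Lemma step_repr_le1 a t0 s : step_repr a t0 s -> t0 <= 1.
Proof.
elim: s t0 => [t0 /= ->//|[t1 m] s IH] t0 /= [t01 _ /IH].
by apply: le_trans; exact: ltW.
Qed.

Lemma step_sol_run_steps a f t0 s x : step_repr a t0 s ->
  step_sol f t0 s x 1 = run_steps f t0 s x.
Proof.
elim: s f t0 => [//|[t1 m] s IH] f t0 /= [t01 _ rs].
have t11 := step_repr_le1 rs.
rewrite leNgt (lt_le_trans t01 t11)/=; case: ifPn => [t1_ge1|_]; last exact: IH.
have t1E : t1 = 1 by apply/eqP; rewrite eq_le t11.
rewrite t1E in rs *; case: s rs {IH} => [//|[t2 m'] s /= [t12 _ /step_repr_le1]].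
by rewrite leNgt t12.
Qed.

Definition unit_valued a : Prop := forall t, 0 <= t <= 1 -> 0 <= a t <= 1.

Lemma step_repr_param a t0 t1 m s : unit_valued a -> 0 <= t0 ->
  step_repr a t0 ((t1, m) :: s) -> 0 <= m <= 1.
Proof.
move=> a01 t00 /= [t01 am rs].
rewrite -(am t1) ?t01 ?lexx//; apply: a01.
by rewrite (step_repr_le1 rs) andbT (le_trans t00)// ltW.
Qed.

(** A first interval may be cut at any interior point: by the semigroup property the
solution is unchanged. *)
Lemma run_steps_advance a f L t0 t1 m s u : unit_valued a -> 0 <= t0 -> lip L f ->
  step_repr a t0 ((t1, m) :: s) -> t0 < u -> u <= t1 ->
  exists r, [/\ step_repr a u r,
    run_steps f t0 ((t1, m) :: s) = run_steps (gauss_step m (u - t0) f) u r,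
    (size r <= (size s).+1)%N & u = t1 -> (size r <= size s)%N].
Proof.
move=> a01 t00 fL rs t0u; have [m0 m1] := andP (step_repr_param a01 t00 rs).
have [t01 am rs'] := rs.
rewrite le_eqVlt => /predU1P[->|ut1]; first by exists s.
exists ((t1, m) :: s); split=> //.
- split=> // t /andP[ut tt1]; apply: am.
  by rewrite (lt_trans t0u ut).
- rewrite /=; congr run_steps; apply/funext => x.
  have u0 : 0 < u - t0 by rewrite subr_gt0.
  have t1u : 0 < t1 - u by rewrite subr_gt0.
  by rewrite (gauss_step_semigroup x fL m0 t1u u0) addrA subrK.
- by move=> ut; rewrite ut ltxx in ut1.
Qed.

Definition gap a a' (t0 : R) : \bar R :=
  (\int[mu]_(t in `]t0, 1%R]) `|a t - a' t|%:E)%E.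

Lemma gap_split a a' t0 u c :
  measurable_fun (`]t0, 1]%classic : set R) (fun t => a t - a' t) ->
  t0 < u -> u <= 1 -> (forall t, t0 < t <= u -> `|a t - a' t| = c) ->
  gap a a' t0 = ((c * (u - t0))%:E + gap a a' u)%E.
Proof.
move=> ma t0u u1 ac.
have split_itv : `]t0, 1]%classic = (`]t0, u] `|` `]u, 1])%classic :> set R.
  by rewrite -itv_bndbnd_setU// bnd_simp ltW.
rewrite /gap split_itv ge0_integral_setU//=; last 2 first.
- apply/measurable_EFinP; apply: measurableT_comp => //.
  by rewrite -split_itv.
- apply/disj_setPS => t /=; rewrite !in_itv/= => -[/andP[_ tu] /andP[ut _]].
  by move: tu; rewrite leNgt ut.
congr (_ + _)%E.
rewrite (eq_integral (fun=> c%:E)); last first.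
  by move=> t; rewrite inE/= in_itv/= => tt; rewrite ac.
rewrite integral_cst//= lebesgue_measure_itv/= lte_fin t0u.
by rewrite -EFinB -EFinM.
Qed.

Lemma gap_ge0 a a' t0 : (0 <= gap a a' t0)%E.
Proof. by apply: integral_ge0 => t _; rewrite lee_fin. Qed.

(** Both subdivisions are read from left to right up to the nearest node of either
one, which shortens at least one of the two lists. *)
Lemma run_steps_dist L a a' f g t0 s s' e x :
  unit_valued a -> unit_valued a' ->
  measurable_fun (`]0, 1]%classic : set R) (fun t => a t - a' t) ->
  0 <= t0 -> lip L f -> lip L g -> (forall z, `|f z - g z| <= e) ->
  step_repr a t0 s -> step_repr a' t0 s' ->
  (`|run_steps f t0 s x - run_steps g t0 s' x|%:E <=
   e%:E + (fluct_moment L)%:E * gap a a' t0)%E.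
Proof.
move=> a01 a'01 ma; move: (leqnn (size s + size s')).
move: {2}(size s + size s')%N => n.
elim: n s s' f g t0 e => [|n IH] s s' f g t0 e sn t00 fL gL fg rs rs'.
  case: s rs sn => [|[? ?] ?] //= t01; case: s' rs' => [|[? ?] ?] // _ _.
  by rewrite (le_trans (y := e%:E)) ?lee_fin ?fg// leeDl// mule_ge0 ?gap_ge0//
    lee_fin fluct_moment_ge0// (lip_ge0 fL).
have K0 : 0 <= fluct_moment L by rewrite fluct_moment_ge0// (lip_ge0 fL).
case: s rs sn => [|[t1 m] s] rs.
  case: s' rs' => [|[t1' m'] s'] rs' sn.
    by apply: IH fg _ _.
  have [t01 _ /step_repr_le1 t11] := rs'.
  by move: rs => /= t0E; move: t01; rewrite t0E ltNge t11.
case: s' rs' => [|[t1' m'] s'] rs' sn.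
  have [t01 _ /step_repr_le1 t11] := rs.
  by move: rs' => /= t0E; move: t01; rewrite t0E ltNge t11.
have m01 := step_repr_param a01 t00 rs; have m'01 := step_repr_param a'01 t00 rs'.
have [[m0 _] [m'0 _]] := (andP m01, andP m'01).
have [t01 am /step_repr_le1 t11] := rs; have [t01' am' /step_repr_le1 t11'] := rs'.
pose u := Num.min t1 t1'.
have t0u : t0 < u by rewrite lt_min t01.
have ut1 : u <= t1 by rewrite ge_min lexx.
have ut1' : u <= t1' by rewrite ge_min lexx orbT.
have u1 : u <= 1 by exact: le_trans t11.
have h01 : 0 < u - t0 <= 1 by rewrite subr_gt0 t0u/=; lra.
have [q [rq runq sq sq']] := run_steps_advance a01 t00 fL rs t0u ut1.
have [p [rp runp sp sp']] := run_steps_advance a'01 t00 gL rs' t0u ut1'.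
have qpn : (size q + size p <= n)%N.
  rewrite /= in sn; move: sn; rewrite addSn ltnS => sn.
  have : u = t1 \/ u = t1' by rewrite /u; case: (leP t1 t1'); [left|right].
  case=> [/sq' sz|/sp' sz].
    by apply: leq_trans (leq_add sz sp) _.
  by apply: leq_trans (leq_add sq sz) _; rewrite addSnnS.
rewrite runq runp.
have fg' z : `|gauss_step m (u - t0) f z - gauss_step m' (u - t0) g z| <=
    e + fluct_moment L * `|m - m'| * (u - t0).
  apply: le_trans (ler_distD (gauss_step m (u - t0) g z) _ _) _; apply: lerD.
    exact: (dist_gauss_step _ fL gL).
  exact: (gauss_step_lip_param z gL).
have u0 : 0 <= u by rewrite (le_trans t00)// ltW.
have fuL : lip L (gauss_step m (u - t0) f) by exact: lip_gauss_step.
have guL : lip L (gauss_step m' (u - t0) g) by exact: lip_gauss_step.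
apply: le_trans (IH _ _ _ _ _ _ qpn u0 fuL guL fg' rq rp) _.
rewrite (@gap_split a a' t0 u `|m - m'|)//; last 2 first.
- apply: measurable_funS ma => //; apply: subset_itv; rewrite bnd_simp//.
- move=> t /andP[t0t tu]; rewrite am ?am' ?t0t ?(le_trans tu)//.
have c0 : (0 <= (`|m - m'| * (u - t0))%:E)%E.
  by rewrite lee_fin mulr_ge0// subr_ge0 ltW.
rewrite (ge0_muleDr _ c0 (gap_ge0 a a' u)).
by rewrite -(mulrA (fluct_moment L)) !EFinD EFinM addeA.
Qed.

Lemma classM_unit_valued a : classM a -> unit_valued a.
Proof. by case. Qed.

Lemma classM_measurable a : classM a ->
  measurable_fun (`[0, 1]%classic : set R) a.
Proof.
move=> [_ ani _].
(* Clamping to the unit interval extends [a] to a monotone function on the line. *)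
pose clamp (t : R) := Num.max 0 (Num.min t 1).
have c01 t : 0 <= clamp t <= 1.
  by rewrite /clamp le_max lexx/= ge_max ler01/= ge_min lexx orbT.
have mc : measurable_fun (`[0, 1]%classic : set R) (a \o clamp).
  apply: nonincreasing_measurable => // s t st /=.
  have [s0 _] := andP (c01 s); have [_ t1] := andP (c01 t).
  by apply: ani => //; rewrite /clamp; apply: le_max2 => //; exact: le_min2.
apply: eq_measurable_fun mc => t; rewrite inE/= in_itv/= => /andP[t0 t1].
by rewrite /clamp (min_idPl t1) (max_idPr t0).
Qed.

Lemma gap_le_dist a a' b : classM a -> classM a' -> classM b ->
  (gap a a' 0 <= \int[mu]_(t in `[0%R, 1%R]) `|a t - b t|%:E +
     \int[mu]_(t in `[0%R, 1%R]) `|a' t - b t|%:E)%E.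
Proof.
move=> /classM_measurable ma /classM_measurable ma' /classM_measurable mb.
have mab : measurable_fun (`[0, 1]%classic : set R) (fun t => `|a t - b t|%:E).
  by apply/measurable_EFinP; apply: measurableT_comp => //; exact: measurable_funB.
have mab' : measurable_fun (`[0, 1]%classic : set R) (fun t => `|a' t - b t|%:E).
  by apply/measurable_EFinP; apply: measurableT_comp => //; exact: measurable_funB.
have maa : measurable_fun (`[0, 1]%classic : set R) (fun t => `|a t - a' t|%:E).
  by apply/measurable_EFinP; apply: measurableT_comp => //; exact: measurable_funB.
rewrite -ge0_integralD//=; [|by move=> t _; rewrite lee_fin..].
apply: (@le_trans _ _ (\int[mu]_(t in `[0%R, 1%R]) `|a t - a' t|%:E)%E).
  by apply: ge0_subset_integral => //; apply: subset_itv; rewrite bnd_simp.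
apply: ge0_le_integral => //.
- exact: emeasurable_funD.
- by move=> t _; rewrite -EFinD lee_fin [`|a' t - b t|]distrC; exact: ler_distD.
Qed.

(** By [run_steps_dist] the values along any admissible sequence are Cauchy, and two
such sequences have the same limit; so the set whose element is selected by
[parisi_sol] is inhabited, and the selected element is a limit along [b]. *)
Lemma parisi_sol_cvg L phi a (b : nat -> R -> R) (r : nat -> seq (R * R)) x :
  lip L phi -> classM a -> (forall n, classM (b n)) ->
  (forall n, step_repr (b n) 0 (r n)) -> L1_cvg b a ->
  run_steps phi 0 (r n) x @[n --> \oo] --> parisi_sol phi a x 1.
Proof.
move=> phiL aM bM br ba.
have K0 : 0 <= fluct_moment L by rewrite fluct_moment_ge0// (lip_ge0 phiL).
have dist (b' b'' : nat -> R -> R) r' r'' n k : (forall n, classM (b' n)) ->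
    (forall n, classM (b'' n)) ->
    (forall n, step_repr (b' n) 0 (r' n)) -> (forall n, step_repr (b'' n) 0 (r'' n)) ->
    (`|run_steps phi 0 (r' n) x - run_steps phi 0 (r'' k) x|%:E <= (fluct_moment L)%:E *
      (\int[mu]_(t in `[0%R, 1%R]) `|b' n t - a t|%:E +
       \int[mu]_(t in `[0%R, 1%R]) `|b'' k t - a t|%:E))%E.
  move=> b'M b''M b'r b''r.
  have mbb : measurable_fun (`]0, 1]%classic : set R) (fun t => b' n t - b'' k t).
    have mb := measurable_funB (classM_measurable (b'M n)) (classM_measurable (b''M k)).
    by apply: measurable_funS mb => //; apply: subset_itv; rewrite bnd_simp.
  have := @run_steps_dist L (b' n) (b'' k) phi phi 0 (r' n) (r'' k) 0 x
    (classM_unit_valued (b'M n)) (classM_unit_valued (b''M k)) mbb (lexx 0)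
    phiL phiL _ (b'r n) (b''r k).
  rewrite add0e => /(_ _)/le_trans; apply.
    by move=> z; rewrite subrr normr0.
  by rewrite lee_wpmul2l ?lee_fin//; exact: gap_le_dist.
have small (b' : nat -> R -> R) (e : R) : 0 < e -> L1_cvg b' a ->
    \forall n \near \oo, (\int[mu]_(t in `[0%R, 1%R]) `|b' n t - a t|%:E <= e%:E)%E.
  move=> e0 /fine_cvgP[fin /cvgr0_norm_le /(_ _ e0) H].
  apply: filterS2 fin H => n In Ie.
  by rewrite -(fineK In) lee_fin (le_trans (ler_norm _)).
suff : [set l : R | forall (a_ : nat -> R -> R) (s_ : nat -> seq (R * R)),
      (forall k, classM (a_ k)) -> (forall k, step_repr (a_ k) 0 (s_ k)) ->
      L1_cvg a_ a -> step_sol phi 0 (s_ k) x 1 @[k --> \oo] --> l]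
    (parisi_sol phi a x 1).
  move=> /= /(_ b r bM br ba); under eq_fun do rewrite (step_sol_run_steps _ _ (br _)).
  exact.
apply: getPex.
have cvgY : cvg (run_steps phi 0 (r n) x @[n --> \oo]).
  apply/cauchy_cvgP/cauchy_exP => e e0.
  (* Two values at L^1 distance at most [d] from the limit differ by at most
     2 d [fluct_moment L]; the 1 keeps the denominator positive. *)
  pose d := e / (2 * (2 * fluct_moment L + 1)).
  have d0 : 0 < d by rewrite divr_gt0// mulr_gt0//; lra.
  have [N _ HN] := small _ _ d0 ba.
  exists (run_steps phi 0 (r N) x); exists N => // n Nn.
  rewrite /ball/= -lte_fin; apply: le_lt_trans (dist _ _ _ _ N n bM bM br br) _.
  apply: (@le_lt_trans _ _ ((fluct_moment L)%:E * (d%:E + d%:E))%E).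
    rewrite lee_wpmul2l ?lee_fin//; apply: leeD; apply: HN => //=.
  rewrite -EFinD -EFinM lte_fin.
  have : (2 * fluct_moment L + 1) * d = e / 2 by rewrite /d; field; rewrite gt_eqF//; lra.
  by move: d0 e0; clear; lra.
exists (lim (run_steps phi 0 (r n) x @[n --> \oo])) => a_ s_ a_M ar aa.
under eq_fun do rewrite (step_sol_run_steps _ _ (ar _)).
apply/cvgrPdist_le => /= e e0.
pose d := e / (2 * (2 * fluct_moment L + 1)).
have d0 : 0 < d by rewrite divr_gt0// mulr_gt0//; lra.
have dE : (2 * fluct_moment L + 1) * d = e / 2.
  by rewrite /d; field; rewrite gt_eqF//; lra.
have e20 : 0 < e / 2 by rewrite divr_gt0.
have sb := small _ _ d0 ba; have sa := small _ _ d0 aa.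
near=> n.
apply: (@le_trans _ _ (e / 2 + fluct_moment L * (d + d))); last first.
  by move: d0 e0 dE; clear; lra.
apply: le_trans (ler_distD (run_steps phi 0 (r n) x) _ _) _; apply: lerD.
  by near: n; apply: cvgr_dist_le.
rewrite -lee_fin; apply: le_trans (dist _ _ _ _ n n bM a_M br ar) _.
rewrite EFinM EFinD lee_wpmul2l ?lee_fin//; apply: leeD.
  by near: n; exact: sb.
by near: n; exact: sa.
Unshelve. all: by end_near.
Qed.

End StepSolutions.

(** * Approximation on uniform grids *)

Section Grid.
Context {R : realType}.
Local Notation mu := (@lebesgue_measure R).
Implicit Types (f g a : R -> R) (m h x t c e L : R).

(** The left endpoint of the cell ]j/(n+1), (j+1)/(n+1)] containing [t].  Using left
endpoints makes the approximation converge at every point, by left continuity;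
the maximum only matters at t = 0, which belongs to no cell. *)
Definition node n t : R :=
  Num.max 0 (((Num.ceil (n.+1%:R * t))%:~R - 1) / n.+1%:R).

Definition grid a n t : R := a (node n t).

Definition grid_list a n i k : seq (R * R) :=
  [seq (j.+1%:R / n.+1%:R, a (j%:R / n.+1%:R)) | j <- iota i k].

Lemma node_ge0 n t : 0 <= node n t.
Proof. by rewrite le_max lexx. Qed.

Lemma node_le n t : 0 <= t -> node n t <= t.
Proof.
move=> t0; rewrite /node ge_max t0/= ler_pdivrMr// [leRHS]mulrC.
by have := ceilB1_lt (n.+1%:R * t); rewrite intrB => /ltW.
Qed.

Lemma node_lt n t : 0 < t -> node n t < t.
Proof.
move=> t0; rewrite /node gt_max t0/= ltr_pdivrMr// [ltRHS]mulrC.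
by have := ceilB1_lt (n.+1%:R * t); rewrite intrB.
Qed.

Lemma sub_le_node n t : t - n.+1%:R^-1 <= node n t.
Proof.
rewrite /node le_max; apply/orP; right.
rewrite ler_pdivlMr// mulrBl mulVf// lerB// mulrC.
exact: ceil_ge.
Qed.

Lemma node_nd n s t : s <= t -> node n s <= node n t.
Proof.
move=> st; rewrite /node; apply: le_max2 => //.
rewrite ler_pM2r ?invr_gt0// lerB// ler_int.
by apply: le_ceil; rewrite ler_wpM2l.
Qed.

Lemma node_left n t s : node n t < s -> s <= t -> node n s = node n t.
Proof.
move=> ns st; rewrite /node; congr (Num.max _ ((_%:~R - _) / _)).
apply/eqP; rewrite eq_le le_ceil/=; last by rewrite ler_wpM2l.
have : Num.ceil (n.+1%:R * t) - 1 < Num.ceil (n.+1%:R * s).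
  rewrite ceil_gt_int intrB; move: ns; rewrite gt_max => /andP[_].
  by rewrite ltr_pdivrMr// [s * _]mulrC.
by rewrite ltrBlDr ltzD1.
Qed.

Lemma node_grid n j t : j%:R / n.+1%:R < t -> t <= j.+1%:R / n.+1%:R ->
  node n t = j%:R / n.+1%:R.
Proof.
rewrite ltr_pdivrMr// ler_pdivlMr// => jt tj; rewrite /node.
have -> : Num.ceil (n.+1%:R * t) = j.+1%:Z.
  apply/eqP; rewrite ceil_eq [_ * t]mulrC intrB -!pmulrn tj andbT.
  by rewrite -[j.+1%:R]natr1 addrK.
by rewrite -pmulrn -[j.+1%:R]natr1 addrK max_r// divr_ge0.
Qed.

Lemma grid_step_repr a n i k : (i + k = n.+1)%N ->
  step_repr (grid a n) (i%:R / n.+1%:R) (grid_list a n i k).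
Proof.
elim: k i => [|k IH] i /=.
  by rewrite addn0 => ->; rewrite divff.
move=> ik; split.
- by rewrite ltr_pM2r ?invr_gt0// ltr_nat.
- by move=> t /andP[it ti]; rewrite /grid (node_grid it ti).
- by apply: IH; rewrite addSnnS.
Qed.

Lemma grid_classM a n : classM a -> classM (grid a n).
Proof.
move=> [a01 ani _]; split.
- move=> t /andP[t0 t1]; apply: a01.
  by rewrite node_ge0/= (le_trans (node_le n t0)).
- move=> s t s0 st t1; apply: ani.
  + exact: node_ge0.
  + exact: node_nd.
  + by apply: le_trans t1; apply: node_le; exact: le_trans st.
- move=> t /andP[t0 t1].
  apply: (@cvg_trans _ (grid a n t @[s --> t^'-])); last exact: cvg_cst.
  apply: near_eq_cvg; near=> s; rewrite /grid.
  rewrite (@node_left n t s)//; near: s.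
  by apply: nbhs_left_gt; exact: node_lt.
Unshelve. all: by end_near. Qed.

Lemma node_cvg t : 0 < t -> node n t @[n --> \oo] --> t^'-.
Proof.
move=> t0.
have nt : node n t @[n --> \oo] --> t.
  apply: (@squeeze_cvgr _ _ _ _ (fun n => t - n.+1%:R^-1) (fun=> t)).
  - by near=> n; rewrite sub_le_node node_le// ltW.
  - rewrite -[X in _ --> X]subr0; apply: cvgB; first exact: cvg_cst.
    exact: cvg_harmonic.
  - exact: cvg_cst.
move=> A /= At.
have : \forall n \near \oo, (node n t < t -> A (node n t)) by exact: nt _ At.
by apply: filterS => n; apply; exact: node_lt.
Unshelve. all: by end_near. Qed.

Lemma grid_L1_cvg a : classM a -> L1_cvg (grid a) a.
Proof.
move=> aM; have [a01 _ acont] := aM.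
pose f_ n (t : R) := (grid a n t)%:E.
have mI : measurable (`[0, 1]%classic : set R) by [].
have bnd (b : R -> R) : classM b -> forall t, `[0, 1]%classic t -> (`|(b t)%:E| <= 1)%E.
  move=> [b01 _ _] t /=; rewrite in_itv/= => /b01 /andP[b0 b1].
  by rewrite lee_fin ger0_norm.
have i1 : mu.-integrable (`[0, 1]%classic : set R) (cst 1%E).
  apply/integrableP; split; first exact: measurable_cst.
  rewrite (eq_integral (cst 1%E)); last by move=> t _; rewrite /= normr1.
  by rewrite integral_cst//= mul1e lebesgue_measure_itv/= lte_fin ltr01 -EFinB ltry.
have mf_ n : measurable_fun (`[0, 1]%classic : set R) (f_ n).
  by apply/measurable_EFinP; exact: (classM_measurable (grid_classM n aM)).
have mf : measurable_fun (`[0, 1]%classic : set R) (EFin \o a).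
  by apply/measurable_EFinP; exact: classM_measurable.
have f_f : {ae mu, forall t, (`[0, 1]%classic : set R) t -> f_ ^~ t @ \oo --> (EFin \o a) t}.
  apply: aeW => t /=; rewrite in_itv/= => /andP[t0 t1].
  apply: cvg_EFin; first by near=> n.
  move: t0; rewrite le_eqVlt => /predU1P[<-|t0].
    have -> : fine \o f_ ^~ 0 = fun=> a 0; last exact: cvg_cst.
    apply/funext => n /=; rewrite /grid; congr a.
    by apply/eqP; rewrite eq_le node_ge0 node_le.
  have at_ : a s @[s --> t^'-] --> a t by apply: acont; rewrite t0.
  exact: cvg_comp (node_cvg t0) at_.
have f_g : {ae mu, forall t n, (`[0, 1]%classic : set R) t -> (`|f_ n t| <= cst 1%E t)%E}.
  by apply: aeW => t n /bnd; apply; exact: grid_classM.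
have [_ + _] :=
  @dominated_convergence _ _ _ mu _ mI f_ (EFin \o a) (cst 1%E) mf_ mf f_f i1 f_g.
apply: cvg_trans; apply: near_eq_cvg; near=> n.
by apply: eq_integral => t _.
Unshelve. all: by end_near. Qed.

End Grid.

(** * From the classes of initial data to finite differences *)

Section Hypotheses.
Context {R : realType}.
Implicit Types (f g phi : R -> R) (x t L : R).

Lemma derivable_MVT phi x y : (forall z, derivable phi z 1) -> x <= y ->
  exists2 c, x <= c <= y & phi y - phi x = (phi^`())%classic c * (y - x).
Proof.
move=> dphi xy.
have dp (z : R) : is_derive z 1 phi ((phi^`())%classic z).
  by rewrite derive1E; exact/derivableP.
have cp : {within `[x, y], continuous phi}.
  apply: continuous_subspaceT => z.
  by apply: differentiable_continuous; exact/derivable1_diffP.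
have [c] := MVT_segment xy (fun z _ => dp z) cp.
by rewrite in_itv/=; exists c.
Qed.

Lemma classC_lip phi : classC phi -> exists L, lip L phi.
Proof.
move=> [dphi _ [B HB] _]; exists B.
suff H x y : x <= y -> `|phi x - phi y| <= B * `|x - y|.
  move=> x y; case/orP: (le_total x y) => xy; first exact: H.
  by rewrite distrC (distrC x); exact: H.
move=> xy; have [c _ E] := derivable_MVT dphi xy.
by rewrite distrC E normrM (distrC x) ler_wpM2r.
Qed.

Lemma lip_le L L' f : L <= L' -> lip L f -> lip L' f.
Proof. by move=> LL fL x y; apply: le_trans (fL x y) _; rewrite ler_wpM2r. Qed.

Lemma convexR_cvx phi : convexR phi -> cvx phi.
Proof.
move=> phic t x y t01.
have := phic (Itv01 (andP t01).1 (andP t01).2) x y.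
rewrite !inE => /(_ Logic.I Logic.I).
by rewrite !convRE/=.
Qed.

(** For 0 <= u < v the point u is a convex combination of v and -v, where the
function takes the same value. *)
Lemma cvx_even_monob phi : cvx phi -> (forall x, phi (- x) = phi x) ->
  monob true phi 0.
Proof.
move=> pc pe x y; rewrite /ord addr0.
have absE u : phi u = phi `|u|.
  by have [u0|u0] := lerP 0 u; [rewrite ger0_norm|rewrite ltr0_norm// pe].
rewrite (absE x) (absE y); move: (normr_ge0 x) `|y| => + v.
move: `|x| => u u0; rewrite le_eqVlt => /predU1P[->//|uv].
have v0 : 0 < v by exact: le_lt_trans uv.
pose t := (u + v) / (2 * v).
have t01 : 0 <= t <= 1.
  rewrite /t divr_ge0/=; [|lra|lra].
  by rewrite ler_pdivrMr ?mul1r; lra.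
have := pc t v (- v) t01; rewrite pe.
have -> : t * v + (1 - t) * - v = u by rewrite /t; field; rewrite gt_eqF.
lra.
Qed.

Lemma classC_diff_nd phi1 phi2 x y : classC phi1 -> classC phi2 -> x <= y ->
  (forall c, x <= c <= y -> (phi1^`())%classic c <= (phi2^`())%classic c) ->
  phi2 x - phi1 x <= phi2 y - phi1 y.
Proof.
move=> [d1 _ _ _] [d2 _ _ _] xy d12.
have dd z : derivable (fun z => phi2 z - phi1 z) z 1 by exact: derivableB.
have [c cxy E] := derivable_MVT dd xy.
rewrite -subr_ge0 E mulr_ge0 ?subr_ge0//.
by rewrite derive1E deriveB// -!derive1E subr_ge0; exact: d12.
Qed.

Lemma classF_dominated phi1 phi2 : classF (phi1, phi2) ->
  exists b L, dominated b L phi1 phi2.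
Proof.
move=> [[/= [C1 C2] [m1 m2] [_ c2] _ d12]|[/= [C1 C2] [e1 e2] [c1 c2] _ d12]].
  have [L1 l1] := classC_lip C1; have [L2 l2] := classC_lip C2.
  exists false, (Num.max L1 L2); split.
  - by split; [apply: lip_le l1|apply: lip_le l2]; rewrite le_max lexx ?orbT.
  - by split=> x y; rewrite /ord addr0; [exact: m1|exact: m2].
  - exact: convexR_cvx.
  - by move=> x y; rewrite /ord addr0 => xy; exact: classC_diff_nd.
have [L1 l1] := classC_lip C1; have [L2 l2] := classC_lip C2.
exists true, (Num.max L1 L2); split.
- by split; [apply: lip_le l1|apply: lip_le l2]; rewrite le_max lexx ?orbT.
- by split; apply: cvx_even_monob => //; exact: convexR_cvx.
- exact: convexR_cvx.
- have absE phi u : (forall x, phi (- x) = phi x) -> phi u = phi `|u| :> R.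
    by move=> pe; have [u0|u0] := lerP 0 u; [rewrite ger0_norm|rewrite ltr0_norm// pe].
  move=> x y; rewrite /ord addr0 => xy.
  rewrite (absE _ x e1) (absE _ x e2) (absE _ y e1) (absE _ y e2).
  apply: classC_diff_nd => // c /andP[xc _]; apply: d12.
  exact: le_trans xc.
Qed.

End Hypotheses.

(** * The convexity inequality *)

Section Conclusion.
Context {R : realType}.
Implicit Types (f g phi a : R -> R) (x t L : R).

Lemma run_steps_grid_convex b L a1 a2 t n k i f f1 f2 : (i + k = n.+1)%N ->
  unit_valued a1 -> unit_valued a2 -> (forall s, 0 <= s <= 1 -> a1 s <= a2 s) ->
  0 <= t <= 1 -> dominated b L f1 f2 -> lip L f ->
  (forall y, f y <= t * f1 y + (1 - t) * f2 y) ->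
  forall x, run_steps f (i%:R / n.+1%:R)
      (grid_list (fun s => t * a1 s + (1 - t) * a2 s) n i k) x <=
    t * run_steps f1 (i%:R / n.+1%:R) (grid_list a1 n i k) x +
    (1 - t) * run_steps f2 (i%:R / n.+1%:R) (grid_list a2 n i k) x.
Proof.
move=> + a101 a201 a12 t01.
elim: k i f f1 f2 => [|k IH] i f f1 f2 ik dom fL ff x; first exact: ff.
have i01 : 0 <= (i%:R / n.+1%:R : R) <= 1.
  rewrite divr_ge0//= ler_pdivrMr// mul1r ler_nat -ik; exact: leq_addr.
have hE : i.+1%:R / n.+1%:R - i%:R / n.+1%:R = n.+1%:R^-1 :> R.
  by rewrite -mulrBl -[i.+1%:R]natr1 addrAC subrr add0r mul1r.
have h01 : 0 < (n.+1%:R^-1 : R) <= 1.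
  by rewrite invr_gt0 ltr0n/= invf_le1// ler1n.
have [m10 _] := andP (a101 _ i01); have [m20 m21] := andP (a201 _ i01).
have m12 := a12 _ i01.
rewrite /= hE; apply: IH; first by rewrite addSnnS.
- exact: dominated_gauss_step.
- apply: lip_gauss_step => //.
  have [t0 t1] := andP t01.
  by rewrite addr_ge0// mulr_ge0// subr_ge0.
- exact: (gauss_step_convex_param h01 m10 m12 m21 t01 dom fL ff).
Qed.

End Conclusion.

Unset Implicit Arguments.

Theorem theorem1 (R : realType) (phi1 phi2 a1 a2 : R -> R)
    (hphi : classF (phi1, phi2))
    (ha1 : classM a1) (ha2 : classM a2)
    (ha : forall t : R, 0 <= t <= 1 -> a1 t <= a2 t)
    (alpha : R) (halpha : 0 <= alpha <= 1) (x : R) :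
  parisi_functional (fun y => alpha * phi1 y + (1 - alpha) * phi2 y) x
                    (fun t => alpha * a1 t + (1 - alpha) * a2 t)
  <= alpha * parisi_functional phi1 x a1
     + (1 - alpha) * parisi_functional phi2 x a2.
Proof.
have [b [L dom]] := classF_dominated hphi.
have [[l1 l2] _ _ _] := dom.
set phi := fun y => _ + _; set a := fun t => _ + _.
have [al0 al1] := andP halpha.
have be0 : 0 <= 1 - alpha by rewrite subr_ge0.
have lphi : lip L phi.
  move=> u v; rewrite /phi (_ : _ - _ =
    alpha * (phi1 u - phi1 v) + (1 - alpha) * (phi2 u - phi2 v)); last by ring.
  apply: le_trans (ler_normD _ _) _; rewrite !normrM (ger0_norm al0) (ger0_norm be0).
  have := ler_wpM2l al0 (l1 u v); have := ler_wpM2l be0 (l2 u v); lra.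
have aM : classM a.
  have [u1 n1 c1] := ha1; have [u2 n2 c2] := ha2; split.
  - move=> t t01; have /andP[p1 q1] := u1 _ t01; have /andP[p2 q2] := u2 _ t01.
    have := ler_wpM2l al0 p1; have := ler_wpM2l al0 q1.
    have := ler_wpM2l be0 p2; have := ler_wpM2l be0 q2.
    by rewrite /a !mulr0 !mulr1; lra.
  - move=> s t s0 st t1; have := ler_wpM2l al0 (n1 s t s0 st t1).
    have := ler_wpM2l be0 (n2 s t s0 st t1); rewrite /a; lra.
  - move=> t t01; apply: cvgD; apply: cvgM; by [exact: cvg_cst|exact: c1|exact: c2].
have lim psi c : lip L psi -> classM c ->
    run_steps psi 0 (grid_list c n 0 n.+1) x @[n --> \oo] --> parisi_functional psi x c.
  move=> psiL cM.
  apply: (@parisi_sol_cvg R L psi c (grid c) (fun n => grid_list c n 0 n.+1) x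
    psiL cM) => [n|n|].
  - exact: grid_classM.
  - by have := grid_step_repr c (add0n n.+1); rewrite mul0r.
  - exact: grid_L1_cvg.
have limr : alpha * run_steps phi1 0 (grid_list a1 n 0 n.+1) x +
      (1 - alpha) * run_steps phi2 0 (grid_list a2 n 0 n.+1) x @[n --> \oo] -->
    alpha * parisi_functional phi1 x a1 + (1 - alpha) * parisi_functional phi2 x a2.
  by apply: cvgD; apply: cvgM; try exact: cvg_cst; exact: lim.
apply: ler_cvg_to (lim _ _ lphi aM) limr _.
near=> n.
have := run_steps_grid_convex (add0n n.+1)
  (classM_unit_valued ha1) (classM_unit_valued ha2) ha
  halpha dom lphi (fun y => lexx _) x.
by rewrite mul0r.
Unshelve. all: by end_near. Qed.
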